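(* Let $(T_n)$ be a sequence of $d$-tuples in the ball $\{\max_j\|T_j\|\le M\}$ of $B(H)^d$ and suppose $Q(T_n)\to G$ in trace norm. Then $$s_\infty(G):=\lim_Ns_N(G)=\lim_N\sup_nh_N(T_n).$$ This limit equals zero if and only if $G=Q(T)$ for a genuine tuple $T$ in the ball, equivalently if and only if $T_n\to T$ strongly-$*$ for some such $T$. The map $T\mapsto Q(T)$, from the ball with the strong-$*$ topology to the trace-class operators with trace norm, is a topological embedding onto its image, and the enhanced map $T\mapsto(Q(T),H(T))$ has closed image in the product of the corresponding trace-class spaces.
   Context: $H$ is an infinite-dimensional separable complex Hilbert space and $R$ is a positive injective Hilbert--Schmidt operator on $H$ with $\|R\|_2=1$, $Re_k=r_ke_k$ for an orthonormal basis $(e_k)$. Fix $d\ge1$, $M<\infty$. For a tuple $T=(T_1,\dots,T_d)$ with $\max_j\|T_j\|\le M$ put $A_0=I$, $A_j=T_j$, $A_{d+j}=T_j^*$ ($1\le j\le d$), $b=2d$, $$B(T)=(A_aR)_{a=0}^b:H^{b+1}\to H,\qquad Q(T)=B(T)^*B(T),\qquad H(T)=\sum_{a=1}^bA_aR^2A_a^*,$$ so $Q(T)$ is the block operator with blocks $Q(T)_{ac}=RA_a^*A_cR$. Let $P_N$ be the projection onto $e_1,\dots,e_N$ and $D_N=\sum_{k\le N}r_k^{-1}e_ke_k^*$. Define $$h_N(T)=\operatorname{Tr}((I-P_N)H(T)),\qquad s_N(G)=\sum_{a=1}^b\big(\operatorname{Tr}G_{aa}-\|D_NG_{0a}\|_2^2\big).$$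 *)

(* Defs.v *)
From HB Require Import structures.
From mathcomp Require Import all_boot all_order all_algebra.
From mathcomp Require Import all_classical all_reals all_analysis.
From mathcomp Require Import complex sesquilinear.

Set Implicit Arguments.
Unset Strict Implicit.
Unset Printing Implicit Defensive.

Import Order.TTheory GRing.Theory Num.Theory.
Import numFieldNormedType.Exports.

Local Open Scope classical_set_scope.
Local Open Scope ring_scope.

HB.mixin Record NormedModule_isInner (K : realType) V & NormedModule K[i] V := {
  inner : {dot V for Num.conj} ;
  innerE : forall x : V, inner x x = `|x| ^+ 2
}.

#[short(type="hilbertType")]
HB.structure Definition Hilbert (K : realType) :=
  {V of CompleteNormedModule K[i] V & NormedModule_isInner K V}.

Section DotNorm.
Variables (C : numClosedFieldType) (U : lmodType C) (f : {dot U for Num.conj}).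

Lemma dot_CauchySchwarz (u v : U) : `|f u v| <= sqrtC (f u u) * sqrtC (f v v).
Proof.
rewrite -(sqrCK (normr_ge0 _)) -sqrtCM ?nnegrE ?dnorm_ge0 //.
rewrite ler_sqrtC ?nnegrE ?mulr_ge0 ?dnorm_ge0 ?exprn_ge0 //.
have [->|v0] := eqVneq v 0.
  by rewrite linear0r normr0 expr0n mulr_ge0 ?dnorm_ge0.
pose a := f u v / f v v; pose u1 := u - a *: v.
have ou : f u1 v = 0 by rewrite linearBl /= linearZl_LR divfK ?dnorm_eq0 ?subrr.
have fvu1 : f v u1 = 0 by rewrite hermC /= ou rmorph0 mulr0.
have -> : u = u1 + a *: v by rewrite subrK.
rewrite linearDl /= ou add0r linearZl_LR /= normrM (ger0_norm (dnorm_ge0 _ _)).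
rewrite dnormD dnormZ linearZr_LR /= ou mulr0 rmorph0 !addr0 mulrDl exprMn.
by rewrite [f v v ^+ 2]expr2 mulrA lerDr mulr_ge0 ?dnorm_ge0.
Qed.

Lemma dot_triangle (u v : U) :
  sqrtC (f (u + v) (u + v)) <= sqrtC (f u u) + sqrtC (f v v).
Proof.
rewrite -ler_sqr ?nnegrE ?addr_ge0 ?sqrtC_ge0 ?dnorm_ge0 //.
rewrite sqrrD !sqrtCK addrAC dnormD lerD2l.
rewrite -mulr_natr -[_ + _](divfK (negbT (pnatr_eq0 C 2))) -/('Re _).
rewrite ler_pM2r ?ltr0n //.
have := le_trans (leif_Re_Creal (f u v)) (dot_CauchySchwarz u v).
by rewrite ReE.
Qed.

End DotNorm.

(* H^n as a Hilbert space: the norm is the Euclidean one *)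
Definition dsum (n : nat) (V : Type) : Type := {ffun 'I_n -> V}.

Section DirectSum.
Variables (K : realType) (n : nat) (H : hilbertType K).

HB.instance Definition _ := GRing.Lmodule.on (dsum n H).

Definition dsum_inner (u v : dsum n H) : K[i] := \sum_i inner (u i) (v i).

Fact dsum_inner_bilinear :
  bilinear_for *%R (Num.conj \; *%R) (dsum_inner : dsum n H -> dsum n H -> K[i]).
Proof.
split=> [w a u v|w a u v]; rewrite /dsum_inner /=;
  rewrite mulr_sumr -big_split /=; apply: eq_bigr => i _; rewrite !ffunE.
  by rewrite linearDl /= linearZl_LR.
by rewrite linearDr /= linearZr_LR.
Qed.

HB.instance Definition _ := bilinear_isBilinear.Build K[i] (dsum n H) (dsum n H)
  K[i] _ _ dsum_inner dsum_inner_bilinear.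

Fact dsum_inner_herm (u v : dsum n H) :
  dsum_inner u v = (-1) ^+ false * Num.conj (dsum_inner v u).
Proof.
rewrite expr0 mul1r rmorph_sum; apply: eq_bigr => i _.
by rewrite hermC /= expr0 mul1r.
Qed.

HB.instance Definition _ := isHermitianSesquilinear.Build K[i] (dsum n H)
  false Num.conj dsum_inner dsum_inner_herm.

Fact dsum_inner_gt0 (u : dsum n H) : u != 0 -> 0 < dsum_inner u u.
Proof.
move=> u0; rewrite lt_def sumr_ge0 ?andbT => [|i _]; last exact: dnorm_ge0.
apply: contra u0; rewrite psumr_eq0 => [/allP u0|i _]; last exact: dnorm_ge0.
apply/eqP/ffunP => i; rewrite ffunE; apply/eqP.
by rewrite -(dnorm_eq0 inner) (eqP (u0 i _)) ?mem_index_enum.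
Qed.

HB.instance Definition _ := isDotProduct.Build K[i] (dsum n H)
  dsum_inner dsum_inner_gt0.

Definition dsum_norm (u : dsum n H) : K[i] := sqrtC (dsum_inner u u).

Fact dsum_normD (u v : dsum n H) :
  dsum_norm (u + v) <= dsum_norm u + dsum_norm v.
Proof. exact: dot_triangle. Qed.

Fact dsum_normZ (a : K[i]) (u : dsum n H) :
  dsum_norm (a *: u) = `|a| * dsum_norm u.
Proof.
rewrite /dsum_norm dnormZ sqrtCM ?nnegrE ?exprn_ge0 ?dnorm_ge0 //.
by rewrite sqrCK.
Qed.

Fact dsum_norm0_eq0 (u : dsum n H) : dsum_norm u = 0 -> u = 0.
Proof. by move/eqP; rewrite sqrt_dnorm_eq0 => /eqP. Qed.

HB.instance Definition _ := Lmodule_isNormed.Build K[i] (dsum n H)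
  dsum_normD dsum_normZ dsum_norm0_eq0.

Fact dsum_innerE (u : dsum n H) : dsum_inner u u = `|u| ^+ 2.
Proof. by rewrite /Num.norm /= sqrtCK. Qed.

Lemma dsum_normE (u : dsum n H) : `|u| ^+ 2 = \sum_i `|u i| ^+ 2.
Proof. by rewrite -dsum_innerE; apply: eq_bigr => i _; rewrite innerE. Qed.

Lemma dsum_norm_coord (u : dsum n H) i : `|u i| <= `|u|.
Proof.
rewrite -ler_sqr ?nnegrE // dsum_normE (bigD1 i) //= lerDl.
by apply: sumr_ge0 => j _; rewrite exprn_ge0.
Qed.

Lemma dsum_norm_le (u : dsum n H) : `|u| <= \sum_i `|u i|.
Proof.
rewrite -ler_sqr ?nnegrE ?sumr_ge0 // dsum_normE.
rewrite [leRHS]expr2 mulr_suml; apply: ler_sum => i _.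
by rewrite expr2 ler_wpM2l // (bigD1 i) //= lerDl sumr_ge0.
Qed.

Fact dsum_complete (F : set_system (dsum n H)) :
  ProperFilter F -> cauchy F -> cvg F.
Proof.
move=> FF /cauchy_ballP Fc.
have cvi i : cvg ((fun u : dsum n H => u i) @ F).
  apply: cauchy_cvg; apply/cauchy_ballP => e e0.
  rewrite near_simpl; have := Fc e e0; apply: filterS => -[u v] /=.
  rewrite -!ball_normE /= => /(le_lt_trans _); apply.
  by have := dsum_norm_coord (u - v) i; rewrite !ffunE.
apply/cvg_ex; exists ([ffun i => lim ((fun u : dsum n H => u i) @ F)] : dsum n H).
apply/cvgrPdist_lt => e e0.
have d0 : 0 < e / n.+1%:R by rewrite divr_gt0 // ltr0n.
near=> u; apply: (le_lt_trans (dsum_norm_le _)).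
apply: (@le_lt_trans _ _ (\sum_(i < n) e / n.+1%:R)).
  apply: ler_sum => i _; rewrite !ffunE ltW //.
  move: (i); near: u; apply: filter_forall => i.
  exact: cvgr_dist_lt (cvi i) _ d0.
rewrite sumr_const card_ord -[_ *+ n]mulr_natr mulrAC ltr_pdivrMr ?ltr0n //.
by rewrite ltr_pM2l // ltr_nat.
Unshelve. all: by end_near. Qed.

HB.instance Definition _ := Uniform_isComplete.Build (dsum n H) dsum_complete.
HB.instance Definition _ := NormedModule_isInner.Build K (dsum n H) dsum_innerE.

End DirectSum.

Section BoundedOperators.
Variables (K : realType) (V W : hilbertType K).

Definition bop_pred : {pred V -> W} :=
  mem [set f : V -> W | linear f /\ continuous f].

Record bop := MkBop { bop_fun :> V -> W; bop_funP : bop_fun \in bop_pred }.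

HB.instance Definition _ := [isSub for bop_fun].
HB.instance Definition _ := [Choice of bop by <:].

Fact bop_submod_closed : submod_closed bop_pred.
Proof.
split=> [|a f g].
  rewrite inE; split=> [b u v|]; first by change (0 = b *: (0 : W) + 0); rewrite scaler0 addr0.
  exact: cst_continuous.
rewrite !inE => -[lf cf] [lg cg]; split=> [b u v|x].
  change (a *: f (b *: u + v) + g (b *: u + v)
    = b *: (a *: f u + g u) + (a *: f v + g v)).
  by rewrite lf lg !scalerDr !scalerA [a * b]mulrC addrACA.
by apply: cvgD; [apply: cvgZr; exact: cf | exact: cg].
Qed.

HB.instance Definition _ :=
  GRing.isSubmodClosed.Build K[i] (V -> W) bop_pred bop_submod_closed.
HB.instance Definition _ := [SubChoice_isSubLmodule of bop by <:].

Fact bop_linear (A : bop) : linear A.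
Proof. by case: A => f /=; rewrite inE => -[]. Qed.

Fact bop_continuous (A : bop) : continuous A.
Proof. by case: A => f /=; rewrite inE => -[]. Qed.

HB.instance Definition _ (A : bop) :=
  GRing.isLinear.Build K[i] V W _ A (@bop_linear A).

Fact bop_subproof (f : V -> W) (c : K[i]) :
  linear f -> (forall x, `|f x| <= c * `|x|) -> f \in bop_pred.
Proof.
move=> lf fc; rewrite inE; split=> // x.
pose lin := GRing.isLinear.Build K[i] V W _ f lf.
pose g : {linear V -> W} := HB.pack f lin.
apply: (@bounded_linear_continuous _ _ _ g).
apply/linear_boundedP; exists `|c|; split; first exact: normr_real.
move=> r cr y; rewrite (le_trans (fc y)) //.
have [->|y0] := eqVneq y 0; first by rewrite normr0 !mulr0.
have c0 : 0 <= c by rewrite -(pmulr_lge0 _ (x := `|y|)) ?normr_gt0 ?(le_trans _ (fc y)).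
by rewrite ler_wpM2r // -(ger0_norm c0) ltW.
Qed.

End BoundedOperators.

Arguments bop {K} V W.
Arguments bop_pred {K} V W.

Section BasicOperators.
Variables (K : realType) (U V W : hilbertType K).

Fact bop_comp_subproof (B : bop V W) (A : bop U V) :
  (B \o A : U -> W) \in bop_pred U W.
Proof.
rewrite inE; split=> [a u v|x] /=; first by rewrite !linearP.
by apply: continuous_comp; exact: bop_continuous.
Qed.

Definition bop_comp B A := MkBop (bop_comp_subproof B A).

Fact bop_id_subproof : (id : V -> V) \in bop_pred V V.
Proof. by rewrite inE; split=> // x; exact: cvg_id. Qed.

Definition bop_id := MkBop bop_id_subproof.

Fact rank1_subproof (u : W) (v : V) :
  (fun x : V => inner x v *: u) \in bop_pred V W.
Proof.
apply: (@bop_subproof _ _ _ _ (`|v| * `|u|)) => [a x y|x].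
  by rewrite linearDl /= linearZl_LR scalerDl scalerA.
rewrite normrZ [leRHS]mulrAC ler_wpM2r //.
rewrite (le_trans (dot_CauchySchwarz _ _ _)) // !innerE !sqrCK //.
by rewrite mulrC.
Qed.

(* the operator u v^* : x |-> <x, v> u *)
Definition rank1 (u : W) (v : V) := MkBop (rank1_subproof u v).

Variable n : nat.

Fact dproj_subproof (i : 'I_n) :
  (fun u : dsum n V => u i) \in bop_pred (dsum n V) V.
Proof.
apply: (@bop_subproof _ _ _ _ 1) => [a u v|u]; first by rewrite !ffunE.
by rewrite mul1r dsum_norm_coord.
Qed.

Definition dproj i : bop (dsum n V) V := MkBop (dproj_subproof i).

Definition dinj_fun (i : 'I_n) (x : V) : dsum n V :=
  [ffun j => if j == i then x else 0].

Fact dinj_subproof (i : 'I_n) : dinj_fun i \in bop_pred V (dsum n V).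
Proof.
apply: (@bop_subproof _ _ _ _ 1) => [a u v|u].
  apply/ffunP => j; rewrite !ffunE; case: eqP => // _.
  by rewrite scaler0 addr0.
rewrite mul1r (le_trans (dsum_norm_le _)) // (bigD1 i) //= big1 => [|j ji].
  by rewrite ffunE eqxx addr0.
by rewrite ffunE (negPf ji) normr0.
Qed.

Definition dinj i : bop V (dsum n V) := MkBop (dinj_subproof i).

End BasicOperators.

Notation "B ** A" := (bop_comp B A) (at level 40, left associativity).
Arguments bop_id {K V}.
Arguments dproj {K V n} i.
Arguments dinj {K V n} i.

Section AdjointAbs.
Variables (K : realType) (V W : hilbertType K).

(* The set has exactly one element, by the Riesz representation theorem. *)
Definition adj (A : bop V W) : bop W V :=
  xget (0 : bop W V) [set S : bop W V | forall x y, inner (A x) y = inner x (S y)].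

Definition positive_op (A : bop V V) := forall x, 0 <= inner (A x) x.

(* |A|, the positive square root of A^* A, which exists and is unique. *)
Definition absop (A : bop V W) : bop V V :=
  xget (0 : bop V V) [set P : bop V V | positive_op P /\ P ** P = adj A ** A].

Definition opnorm (A : bop V W) : \bar K :=
  ereal_sup [set (complex.Re `|A x|)%:E | x in [set x : V | `|x| <= 1]].

End AdjointAbs.

Section Traces.
Variables (K : realType) (I : choiceType) (V : hilbertType K).

Definition is_onb (f : I -> V) :=
  (forall i j, inner (f i) (f j) = (i == j)%:R) /\
  (forall x, (forall i, inner x (f i) = 0) -> x = 0).

(* The quantities below are computed in an orthonormal basis f, on the choice
   of which they do not depend. *)

Definition hs_norm2 (W : hilbertType K) (f : I -> V) (A : bop V W) : \bar K :=
  (\esum_(i in setT) (complex.Re (`|A (f i)| ^+ 2))%:E)%E.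

Definition trace_norm (f : I -> V) (A : bop V V) : \bar K :=
  (\esum_(i in setT) (complex.Re (inner (absop A (f i)) (f i)))%:E)%E.

Definition trace_class (f : I -> V) : set (bop V V) :=
  [set A | (trace_norm f A < +oo)%E].

(* Only used for trace class operators, for which the series converges
   absolutely. *)
Definition optrace (e : nat -> V) (A : bop V V) : K[i] :=
  limn (fun n => \sum_(k < n) inner (A (e k)) (e k) : K[i]^o).

(* B(V) with the (possibly infinite) distance given by the trace norm. The
   trace class operators form an open and closed subset, whose subspace topology
   is that of the trace norm. *)
Definition trace_space (f : I -> V) : Type := bop V V.

Variable f : I -> V.

HB.instance Definition _ := GRing.Lmodule.on (trace_space f).

Definition trace_open : set_system (trace_space f) :=
  [set U : set (bop V V) | forall A : bop V V, U A -> exists2 eps : K, 0 < eps &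
    [set A' | (trace_norm f (A' - A)%R < eps%:E)%E] `<=` U].

Fact trace_openT : trace_open setT.
Proof. by move=> A _; exists 1. Qed.

Fact trace_openI : setI_closed trace_open.
Proof.
move=> U U' oU oU' A [/oU[a a0 aU] /oU'[b b0 bU']].
exists (Num.min a b) => [|A' /= lt]; first by rewrite lt_min a0 b0.
split; [apply: aU | apply: bU']; apply: (lt_le_trans lt);
  by rewrite lee_fin ge_min lexx ?orbT.
Qed.

Fact trace_open_bigU (J : Type) (U : J -> set (trace_space f)) :
  (forall j, trace_open (U j)) -> trace_open (\bigcup_j U j).
Proof.
move=> oU A [j _ /oU[a a0 aU]]; exists a => // A' /aU UA'; by exists j.
Qed.

HB.instance Definition _ := isOpenTopological.Build (trace_space f)
  trace_openT trace_openI trace_open_bigU.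

End Traces.

Section StrongStar.
Variables (K : realType) (H : hilbertType K) (d : nat).

Definition optuple : Type := 'I_d -> bop H H.

Definition strong_star_eval (T : optuple) : {ptws ('I_d * H) -> (H * H)%type} :=
  fun p => (T p.1 p.2, adj (T p.1) p.2).

(* the strong-* topology: the coarsest one such that all the maps
   T |-> T_j x and T |-> T_j^* x are continuous *)
HB.instance Definition _ :=
  Topological.copy optuple (initial_topology strong_star_eval).

Definition opball (M : K) : set optuple :=
  [set T | forall j, (opnorm (T j) <= M%:E)%E].

End StrongStar.

(* f restricted to A is a homeomorphism of A onto f(A) *)
Definition embedding_on (X Y : topologicalType) (A : set X) (f : X -> Y) :=
  [/\ set_inj A f, {within A, continuous f} &
    forall U, open U -> exists2 V, open V & f @` (A `&` U) = f @` A `&` V].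

Section Construction.
Variables (K : realType) (H : hilbertType K) (d : nat).
Implicit Types (T : optuple H d) (R : bop H H) (e : nat -> H) (r : nat -> K).

(* A_0 = I, A_j = T_j, A_{d+j} = T_j^* *)
Definition Aop T (a : 'I_(d + d).+1) : bop H H :=
  if unlift ord0 a is Some j then
    match fintype.split (j : 'I_(d + d)) with inl k => T k | inr k => adj (T k) end
  else bop_id.

Definition Brow R T : bop (dsum (d + d).+1 H) H :=
  \sum_a (Aop T a ** R) ** dproj a.

Definition Qop R T : bop (dsum (d + d).+1 H) (dsum (d + d).+1 H) :=
  adj (Brow R T) ** Brow R T.

Definition Hop R T : bop H H :=
  \sum_(a | a != ord0) Aop T a ** (R ** R) ** adj (Aop T a).

Definition block (G : bop (dsum (d + d).+1 H) (dsum (d + d).+1 H)) a c :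
  bop H H := dproj a ** G ** dinj c.

Definition dsum_basis e (p : 'I_(d + d).+1 * nat) : dsum (d + d).+1 H :=
  dinj p.1 (e p.2).

Definition Pop e N : bop H H := \sum_(k < N) rank1 (e k) (e k).

Definition Dop e r N : bop H H :=
  \sum_(k < N) ((r k)^-1)%:C%C *: rank1 (e k) (e k).

(* The trace is that of the positive operator (I - P_N) H(T) (I - P_N), so that
   taking the real part is a mere cast. *)
Definition h_ e R T N : K := complex.Re (optrace e ((bop_id - Pop e N) ** Hop R T)).

(* G_aa is positive when G is a limit of operators Q(T); the Hilbert-Schmidt norm
   is finite since D_N has finite rank. *)
Definition s_ e r (G : bop (dsum (d + d).+1 H) (dsum (d + d).+1 H)) N : \bar K :=
  (\sum_(a | a != ord0) ((complex.Re (optrace e (block G a a)))%:E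
     - hs_norm2 e (Dop e r N ** block G ord0 a)))%E.

End Construction.

Arguments opball {K} H d M.
Arguments dsum_basis {K H} d e p.

(* Main.v *)
Require Import Defs.
From mathcomp Require Import all_boot all_order all_algebra.
From mathcomp Require Import all_classical all_reals all_analysis.
From mathcomp Require Import complex sesquilinear.
From mathcomp Require Import ring lra.

(** Everything is read off the entries of Q(T) in the basis f of H^(b+1), which
    are the numbers <A_a R e_k, A_c R e_l>.  The diagonal ones are the squared
    norms of the vectors A_a R e_k, and those with c = 0, divided by r_l, are
    the coordinates of these vectors.  For an arbitrary operator G call
    Sum_(a > 0) (<G_aa e_k, e_k> - |D_N G_0a e_k|^2) its defect at N and k.  The
    defect of Q(T) adds up the squared norms of the parts of the A_a R e_k beyond the
    first N coordinates.  Its sum over k is s_N(G) in general (s_defect_sum) and,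
    for G = Q(T), also h_N(T) by Tonelli (h_defect_sum).

    On the ball, the defects are dominated by a constant multiple of r_k^2.
    Hence mere entrywise convergence of Q(T_n) to G implies that h_N(T_n) tends
    to s_N(G) for every N.  As h_N(T) decreases to 0 in N for each T, a
    Dini argument (dini_sup) identifies the two limits of the theorem; call their
    common value s.  If s = 0, the vectors A_a R e_k of T_n have uniformly small
    tails; their coordinates converge, so they converge in norm, and since the
    operators are bounded and R has dense range the tuples converge strongly-*
    (strong_limit).  If G = Q(T), then s_N(G) = h_N(T) tends to 0.

    The trace norm enters through trace_norm_leP, which describes it as
    the supremum of Sum |<D f_i, U f_i>| over nonexpansive U and finite partial
    sums.  The triangle inequality, the bounds on entries and on traces, and the
    product estimate trace_norm_adj_comp for Hilbert-Schmidt operators follow.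
    The last gives the continuity of Q (Qop_continuous).  The inverse of Q is
    continuous because trace-norm convergence Q(T_n) -> Q(T) implies entrywise
    convergence with s = 0.  For the enhanced map, convergence of H(T_n) in trace
    norm to a trace class operator makes the tails of Tr H(T_n) uniformly small;
    this forces s = 0 for every point in the closure of the image.

    The operator theory needed is derived from one variational principle
    (symmetric_lax_milgram), which provides adjoints and resolvents, and from an
    iteration for square roots (positive_sqrt_le1), which provides |D|. *)

Set Implicit Arguments.
Unset Strict Implicit.
Unset Printing Implicit Defensive.

Import Order.TTheory GRing.Theory Num.Theory.
Import numFieldNormedType.Exports.

Local Open Scope classical_set_scope.
Local Open Scope ring_scope.

(** * Real-valued norms and inner products *)

Section RealParts.
Variable K : realType.
Implicit Types z w : K[i].

(** Norms over K[i] take values in K[i], where the order is only partial; their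
    real parts cabs and hnorm allow real arithmetic. *)
Definition cabs z : K := complex.Re `|z|.

Lemma normc_cabs z : `|z| = (cabs z)%:C%C.
Proof. by rewrite /cabs RRe_real // normr_real. Qed.

Lemma lecC (a b : K) : (a%:C%C <= b%:C%C :> K[i]) = (a <= b).
Proof. by rewrite lecE /= eqxx. Qed.

Lemma ltcC (a b : K) : (a%:C%C < b%:C%C :> K[i]) = (a < b).
Proof. by rewrite ltcE /= eqxx. Qed.

Lemma lec0C (a : K) : (0 <= a%:C%C :> K[i]) = (0 <= a).
Proof. by rewrite lecE /= eqxx. Qed.

Lemma ltc0C (a : K) : (0 < a%:C%C :> K[i]) = (0 < a).
Proof. by rewrite ltcE /= eqxx. Qed.

Lemma cabs_ge0 z : 0 <= cabs z.
Proof. by rewrite -lec0C -normc_cabs normr_ge0. Qed.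

Lemma cabs_sqr z : cabs z ^+ 2 = complex.Re z ^+ 2 + complex.Im z ^+ 2.
Proof.
by apply: complexI; rewrite add_Re2_Im2 normc_cabs rmorphXn.
Qed.

Lemma cabsM z w : cabs (z * w) = cabs z * cabs w.
Proof. by apply: complexI; rewrite rmorphM /= -!normc_cabs normrM. Qed.

Lemma ler_cabsD z w : cabs (z + w) <= cabs z + cabs w.
Proof. by rewrite -lecC rmorphD /= -!normc_cabs ler_normD. Qed.

Lemma cabsC (a : K) : cabs a%:C%C = `|a|.
Proof.
apply/eqP; rewrite -(eqrXn2 (n := 2)) ?cabs_ge0 // cabs_sqr /=.
by rewrite expr0n addr0 real_normK ?num_real.
Qed.

Lemma cabs_conj z : cabs (Num.conj z) = cabs z.
Proof. by rewrite /cabs norm_conjC. Qed.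

Lemma ler_norm_Re z : `|complex.Re z| <= cabs z.
Proof. by rewrite -lecC -normc_cabs normc_ge_Re. Qed.

Lemma Re_le_cabs z : complex.Re z <= cabs z.
Proof. exact: le_trans (ler_norm _) (ler_norm_Re z). Qed.

Lemma cabs_eq0 z : cabs z = 0 -> z = 0.
Proof. by move=> z0; apply/normr0_eq0; rewrite normc_cabs z0. Qed.

Lemma ReD z w : complex.Re (z + w) = complex.Re z + complex.Re w.
Proof. by case: z; case: w. Qed.

Lemma ReN z : complex.Re (- z) = - complex.Re z.
Proof. by case: z. Qed.

Lemma Re_sum (I : Type) (s : seq I) (P : pred I) (F : I -> K[i]) :
  complex.Re (\sum_(i <- s | P i) F i) = \sum_(i <- s | P i) complex.Re (F i).
Proof. by elim/big_rec2: _ => // i x y _ <-; rewrite ReD. Qed.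

Lemma Re_scale (a : K) z : complex.Re (a%:C%C * z) = a * complex.Re z.
Proof. by case: z => x y /=; rewrite mul0r subr0. Qed.

Variable V : hilbertType K.
Implicit Types x y : V.

Definition hnorm x : K := complex.Re `|x|.

Definition rdot x y : K := complex.Re (inner x y).

Lemma normr_hnorm x : `|x| = (hnorm x)%:C%C.
Proof. by rewrite /hnorm RRe_real // normr_real. Qed.

Lemma hnorm_ge0 x : 0 <= hnorm x.
Proof. by rewrite -lec0C -normr_hnorm normr_ge0. Qed.

Lemma ler_hnormD x y : hnorm (x + y) <= hnorm x + hnorm y.
Proof. by rewrite -lecC rmorphD /= -!normr_hnorm ler_normD. Qed.

Lemma hnormZ (a : K[i]) x : hnorm (a *: x) = cabs a * hnorm x.
Proof. by apply: complexI; rewrite rmorphM /= -normc_cabs -!normr_hnorm normrZ. Qed.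

Lemma hnormN x : hnorm (- x) = hnorm x.
Proof. by rewrite /hnorm normrN. Qed.

Lemma hnorm0 : hnorm 0 = 0.
Proof. by rewrite /hnorm normr0. Qed.

Lemma hnorm_eq0 x : hnorm x = 0 -> x = 0.
Proof. by move=> x0; apply/normr0_eq0; rewrite normr_hnorm x0. Qed.

Lemma hdistC x y : hnorm (x - y) = hnorm (y - x).
Proof. by rewrite -hnormN opprB. Qed.

Lemma innerxx x : inner x x = (hnorm x ^+ 2)%:C%C.
Proof. by rewrite innerE normr_hnorm rmorphXn. Qed.

Lemma rdotxx x : rdot x x = hnorm x ^+ 2.
Proof. by rewrite /rdot innerxx. Qed.

Lemma Re_normr2 x : complex.Re (`|x| ^+ 2) = hnorm x ^+ 2.
Proof. by rewrite normr_hnorm -rmorphXn. Qed.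

Lemma innerC x y : inner x y = Num.conj (inner y x).
Proof. by rewrite hermC /= expr0 mul1r. Qed.

Lemma rdotC x y : rdot x y = rdot y x.
Proof. by rewrite /rdot innerC; case: (inner y x). Qed.

Lemma rdotDl x y (z : V) : rdot (x + y) z = rdot x z + rdot y z.
Proof. by rewrite /rdot linearDl /= ReD. Qed.

Lemma rdotDr x y (z : V) : rdot z (x + y) = rdot z x + rdot z y.
Proof. by rewrite /rdot linearDr /= ReD. Qed.

Lemma rdotNl x y : rdot (- x) y = - rdot x y.
Proof. by rewrite /rdot linearNl /= ReN. Qed.

Lemma rdotNr x y : rdot x (- y) = - rdot x y.
Proof. by rewrite /rdot linearNr /= ReN. Qed.

Lemma rdotZl (a : K) x y : rdot (a%:C%C *: x) y = a * rdot x y.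
Proof. by rewrite /rdot linearZl_LR Re_scale. Qed.

Lemma rdotZr (a : K) x y : rdot x (a%:C%C *: y) = a * rdot x y.
Proof. by rewrite rdotC rdotZl rdotC. Qed.

Lemma rdot0l x : rdot 0 x = 0.
Proof. by rewrite /rdot linear0l. Qed.

(** Hence the real parts alone determine inner products. *)
Lemma Im_inner x y : complex.Im (inner x y) = - rdot ('i%C *: x) y.
Proof.
rewrite /rdot linearZl_LR /=; case: (inner x y) => a b /=.
by rewrite mul0r mul1r sub0r opprK.
Qed.

Lemma inner_rdot x y (z : K[i]) :
  rdot x y = complex.Re z -> rdot ('i%C *: x) y = - complex.Im z ->
  inner x y = z.
Proof.
move=> h1 h2; apply/eqP; rewrite eq_complex Im_inner h2 opprK eqxx andbT.
exact/eqP.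
Qed.

Lemma cabs_inner x y : cabs (inner x y) <= hnorm x * hnorm y.
Proof.
rewrite -lecC rmorphM /= -normc_cabs -!normr_hnorm.
by rewrite (le_trans (dot_CauchySchwarz _ _ _)) // !innerE !sqrCK.
Qed.

Lemma ler_rdot x y : `|rdot x y| <= hnorm x * hnorm y.
Proof. exact: le_trans (ler_norm_Re _) (cabs_inner x y). Qed.

Lemma hnormD_sqr x y :
  hnorm (x + y) ^+ 2 = hnorm x ^+ 2 + hnorm y ^+ 2 + 2 * rdot x y.
Proof. by rewrite -!rdotxx rdotDl !rdotDr [rdot y x]rdotC; ring. Qed.

Lemma inner_eq0 x : (forall y, inner y x = 0) -> x = 0.
Proof.
move=> h; apply: hnorm_eq0; apply/eqP; rewrite -sqrf_eq0.
by rewrite -rdotxx /rdot h.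
Qed.

Lemma inner_inj x y : (forall v, inner v x = inner v y) -> x = y.
Proof.
move=> h; apply/eqP; rewrite -subr_eq0; apply/eqP/inner_eq0 => v.
by rewrite linearBr /= h subrr.
Qed.

End RealParts.

Section Convergence.
Variables (K : realType) (V : hilbertType K).

Lemma cvg_hnormP (T : Type) (F : set_system T) {FF : Filter F} (u : T -> V) l :
  u @ F --> l <-> forall eps : K, 0 < eps -> \forall t \near F, hnorm (l - u t) < eps.
Proof.
split=> [/cvgrPdist_lt ul eps eps0|ul].
  have e0 : 0 < eps%:C%C by rewrite ltc0C.
  by near=> t; rewrite -ltcC -normr_hnorm; near: t; exact: ul.
apply/cvgrPdist_lt => eps eps0.
have epsE : eps = (complex.Re eps)%:C%C by rewrite RRe_real // gtr0_real.
have e0 : 0 < complex.Re eps by rewrite -ltc0C -epsE.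
by near=> t; rewrite epsE normr_hnorm ltcC; near: t; exact: ul.
Unshelve. all: by end_near. Qed.

Lemma cvg_hnorm_seqP (u : nat -> V) l :
  u n @[n --> \oo] --> l <->
  forall eps : K, 0 < eps -> exists N, forall n, (N <= n)%N -> hnorm (l - u n) < eps.
Proof.
rewrite cvg_hnormP; split=> h eps /h [N]; first by move=> _ hN; exists N.
by move=> hN; exists N.
Qed.

Lemma hcauchy_cvg (u : nat -> V) :
  (forall eps : K, 0 < eps -> exists N, forall m n, (N <= m)%N -> (N <= n)%N ->
     hnorm (u m - u n) < eps) ->
  exists l : V, u n @[n --> \oo] --> l.
Proof.
move=> h; suff cu : cvg (u n @[n --> \oo]) by exists (lim (u n @[n --> \oo])).
apply: cauchy_cvg; apply/cauchy_ballP => eps eps0.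
have epsE : eps = (complex.Re eps)%:C%C by rewrite RRe_real // gtr0_real.
have e0 : 0 < complex.Re eps by rewrite -ltc0C -epsE.
have [N hN] := h _ e0.
exists ([set u n | n in [set n | (N <= n)%N]],
        [set u n | n in [set n | (N <= n)%N]]).
  by split; exists N => // n /= Nn; exists n.
case=> x y /= [[m Nm <-] [n Nn <-]].
by rewrite -ball_normE /= normr_hnorm epsE ltcC; exact: hN.
Qed.

Lemma cvg_inner (T : Type) (F : set_system T) {FF : Filter F} (u : T -> V) l y :
  u @ F --> l -> forall eps : K, 0 < eps ->
  \forall t \near F, cabs (inner (l - u t) y) < eps.
Proof.
move=> /cvg_hnormP ul eps e0.
have d0 : 0 < eps / (hnorm y + 1) by rewrite divr_gt0 // ltr_wpDl // hnorm_ge0.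
near=> t; apply: le_lt_trans (cabs_inner _ _) _.
have : hnorm (l - u t) < eps / (hnorm y + 1) by near: t; exact: ul.
rewrite ltr_pdivlMr ?ltr_wpDl ?hnorm_ge0 // => /(le_lt_trans _); apply.
by rewrite ler_wpM2l ?hnorm_ge0 // lerDl.
Unshelve. all: by end_near. Qed.

Lemma le0_eps (a : K) : (forall eps, 0 < eps -> a <= eps) -> a <= 0.
Proof. by move=> h; apply/ler_addgt0Pl => eps e0; rewrite addr0; exact: h. Qed.

End Convergence.

Section Bounded.
Variables (K : realType).
Implicit Types V W : hilbertType K.

Lemma bop_bounded V W (A : bop V W) :
  exists2 c : K, 0 <= c & forall x, hnorm (A x) <= c * hnorm x.
Proof.
have /linear_boundedP [c [creal hc]] : bounded_near A (nbhs 0).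
  by apply/linear_bounded_continuous; exact: bop_continuous.
pose c1 := cabs c + 1.
have c1P : c < c1%:C%C.
  rewrite rmorphD /= -normc_cabs; apply: le_lt_trans (real_ler_norm creal) _.
  by rewrite ltrDl.
exists c1 => [|x]; first by rewrite addr_ge0 // cabs_ge0.
by have := hc _ c1P x; rewrite !normr_hnorm -rmorphM lecC.
Qed.

Definition nonexpansive V W (A : bop V W) := forall x, hnorm (A x) <= hnorm x.

Lemma bop_mk_subproof V W (f : V -> W) (c : K) :
  linear f -> (forall x, hnorm (f x) <= c * hnorm x) -> f \in bop_pred V W.
Proof.
move=> lf fc; apply: (bop_subproof (c := c%:C%C)) => // x.
by rewrite !normr_hnorm -rmorphM lecC.
Qed.

Lemma bop_mk V W (f : V -> W) (c : K) :
  linear f -> (forall x, hnorm (f x) <= c * hnorm x) ->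
  exists A : bop V W, A =1 f.
Proof. by move=> lf fc; exists (MkBop (bop_mk_subproof lf fc)). Qed.

Lemma bopE V W (A B : bop V W) : A =1 B -> A = B.
Proof. by move=> AB; apply/val_inj/funext. Qed.

Lemma bopD V W (A B : bop V W) x : (A + B) x = A x + B x. Proof. by []. Qed.
Lemma bopB V W (A B : bop V W) x : (A - B) x = A x - B x. Proof. by []. Qed.
Lemma bopZ V W a (A : bop V W) x : (a *: A) x = a *: A x. Proof. by []. Qed.

Lemma bop_sum V W (I : Type) (s : seq I) (P : pred I) (A : I -> bop V W) x :
  (\sum_(i <- s | P i) A i) x = \sum_(i <- s | P i) A i x.
Proof. by elim/big_rec2: _ => // i y1 y2 _ <-. Qed.

End Bounded.

(** * Adjoints, inverses and square roots *)

Section Operators.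
Variable K : realType.
Implicit Types V W : hilbertType K.

(** The direct method of the calculus of variations: the functional
    <Bx, x> - 2 Re <Ax, y> is bounded below, the parallelogram law makes its
    minimizing sequences Cauchy, and the vanishing of its first variation at the
    limit is the announced identity.  With B = I this is the Riesz
    representation theorem, and with A = I it inverts B. *)
Lemma symmetric_lax_milgram V W (B : bop V V) (A : bop V W) (y : W) (c : K) :
  0 < c -> (forall x x', inner (B x) x' = inner x (B x')) ->
  (forall x, c * hnorm x ^+ 2 <= rdot (B x) x) ->
  exists v, forall x, inner (A x) y = inner x (B v).
Proof.
move=> c0 Bsym Bc.
pose q x := rdot (B x) x; pose phi x := rdot (A x) y.
pose J x := q x - 2 * phi x.
have phiD x z : phi (x + z) = phi x + phi z by rewrite /phi linearD rdotDl.
have phiZ (t : K) x : phi (t%:C%C *: x) = t * phi x.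
  by rewrite /phi linearZ /= rdotZl.
have Bsym2 x z : rdot (B x) z = rdot x (B z) by rewrite /rdot Bsym.
have Bsym' x z : rdot (B x) z = rdot (B z) x by rewrite Bsym2 rdotC.
have qD (t : K) x z :
    q (x + t%:C%C *: z) = q x + 2 * t * rdot (B x) z + t ^+ 2 * q z.
  rewrite /q linearD linearZ /= !rdotDl !rdotDr !rdotZl !rdotZr (Bsym' z x).
  by ring.
have JD (t : K) x z : J (x + t%:C%C *: z) =
    J x + 2 * t * (rdot (B x) z - phi z) + t ^+ 2 * q z.
  by rewrite /J qD phiD phiZ; ring.
have [cA cA0 hA] := bop_bounded A.
pose d := cA * hnorm y.
have phi_le x : phi x <= d * hnorm x.
  apply: le_trans (ler_norm _) (le_trans (ler_rdot _ _) _).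
  by rewrite /d mulrAC ler_wpM2r ?hnorm_ge0.
have J_ge x : - (d ^+ 2 / c) <= J x.
  rewrite -mulNr ler_pdivrMr // /J.
  have := Bc x; have := phi_le x; rewrite -/(q x).
  move: (hnorm x) (phi x) (q x) => t p u.
  rewrite -subr_ge0 -[c * _ <= _]subr_ge0 => /(mulr_ge0 (ltW c0)) h1.
  move=> /(mulr_ge0 (ltW c0)) h2; have := sqr_ge0 (c * t - d); lra.
pose E := [set J x | x in setT].
have E_lb : has_lbound E.
  by exists (- (d ^+ 2 / c)) => _ [x _ <-].
have infE : has_inf E by split => //; exists (J 0), 0.
pose m := inf E.
have mJ x : m <= J x by apply: ge_inf => //; exists x.
have /choice [xn hxn] : forall n, exists x, J x < m + n.+1%:R^-1.
  by move=> n; have [|_ [x _ <-] hx] := @inf_adherent _ E n.+1%:R^-1 _ infE; last exists x.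
have par x z : c * hnorm (x - z) ^+ 2 <= 2 * (J x - m) + 2 * (J z - m).
  apply: le_trans (Bc _) _; rewrite -/(q _).
  have := mJ (x + (2^-1)%:C%C *: (z - x)).
  rewrite JD.
  have -> : q (x - z) = q (z - x).
    by rewrite /q -opprB linearN /= rdotNl rdotNr opprK.
  have := JD 1 x (z - x); rewrite scale1r subrKC => ->.
  by move: (rdot _ _) (phi _) (q _) (J _) => a b e f; nra.
have [v hv] : exists v : V, xn n @[n --> \oo] --> v.
  apply: hcauchy_cvg => eps e0.
  pose N := Num.truncn (4 / (c * eps ^+ 2)).
  have hN n : (N <= n)%N -> 4 * n.+1%:R^-1 < c * eps ^+ 2.
    move=> Nn; rewrite ltr_pdivrMr // mulrC -ltr_pdivrMr ?mulr_gt0 ?exprn_gt0 //.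
    by apply: lt_le_trans (truncnS_gt _) _; rewrite ler_nat ltnS.
  exists N => a b /hN Na /hN Nb.
  rewrite -(ltr_pXn2r (n := 2)) ?nnegrE ?hnorm_ge0 ?ltW // -(ltr_pM2l c0).
  apply: le_lt_trans (par _ _) _.
  have := hxn a; have := hxn b; move: Na Nb.
  move: (a.+1%:R^-1) (b.+1%:R^-1) (J _) (J _) (c * _) => *; lra.
exists v.
have var x t : 0 <= 2 * t * (rdot (B v) x - phi x) + t ^+ 2 * q x.
  rewrite -oppr_le0; apply: le0_eps => eps e0.
  pose f := eps / 2 / (2 * `|t| + 1).
  have t0 : 0 < 2 * `|t| + 1 by rewrite ltr_wpDl // mulr_ge0.
  have f0 : 0 < f by rewrite !divr_gt0.
  have [N _ hN] := cvg_inner (B x) hv f0.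
  pose n := maxn N (Num.truncn (2 / eps)).
  have h1 : `|rdot (B v) x - rdot (B (xn n)) x| < f.
    rewrite !Bsym2 -rdotNl -rdotDl; apply: le_lt_trans (ler_norm_Re _) _.
    by apply: hN; rewrite /= leq_maxl.
  have h2 : n.+1%:R^-1 < eps / 2.
    rewrite -[n.+1%:R^-1]mul1r ltr_pdivrMr // mulrC -ltr_pdivrMr ?divr_gt0 //.
    rewrite mul1r invf_div; apply: lt_le_trans (truncnS_gt _) _.
    by rewrite ler_nat ltnS leq_maxr.
  have h3 : f * (2 * `|t|) + f = eps / 2 by rewrite -{2}[f]mulr1 -mulrDr divfK ?gt_eqF.
  have := mJ (xn n + t%:C%C *: x); have := hxn n; rewrite JD.
  have : `|t * (rdot (B v) x - rdot (B (xn n)) x)| <= `|t| * f.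
    by rewrite normrM ler_wpM2l // ltW.
  rewrite ler_norml => /andP[]; move: h2 h3 f0.
  move: (rdot _ _) (rdot _ _) (phi _) (q _) (J _) (n.+1%:R^-1) (t ^+ 2) => *.
  nra.
have dJ x : rdot (B v) x = phi x.
  have := var x; have := Bc x; rewrite -/(q x).
  have : 0 <= c * hnorm x ^+ 2 by rewrite mulr_ge0 ?exprn_ge0 ?hnorm_ge0 // ltW.
  move: (c * _) (rdot _ _) (phi x) (q x) => w a b u w0 wu h.
  have u0 : 0 < u + 1 by lra.
  have := h (- (a - b) / (u + 1)).
  have -> : 2 * (- (a - b) / (u + 1)) * (a - b) + (- (a - b) / (u + 1)) ^+ 2 * u =
      - ((a - b) ^+ 2 * (u + 2) / (u + 1) ^+ 2) by field; lra.
  rewrite oppr_ge0 pmulr_lle0 ?invr_gt0 ?exprn_gt0 // pmulr_lle0; last lra.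
  by move=> ab; apply/eqP; rewrite -subr_eq0 -sqrf_eq0 eq_le ab sqr_ge0.
move=> x; apply: inner_rdot; first by rewrite -/(phi x) -dJ rdotC.
by rewrite Im_inner opprK (rdotC _ (B v)) dJ /phi linearZ.
Qed.

Lemma adj_exists V W (A : bop V W) :
  exists S : bop W V, forall x y, inner (A x) y = inner x (S y).
Proof.
have /choice [S hS] : forall y, exists v, forall x, inner (A x) y = inner x v.
  move=> y; have [|//|x|v hv] := @symmetric_lax_milgram V W bop_id A y 1.
  - exact: ltr01.
  - by rewrite mul1r rdotxx.
  - by exists v.
have [c c0 hc] := bop_bounded A.
have [] := @bop_mk _ _ _ S c.
- move=> a y z; apply: inner_inj => x.
  by rewrite -hS !linearDr /= !linearZr_LR /= !hS.
- move=> y; have [->|Sy0] := eqVneq (hnorm (S y)) 0.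
    by rewrite mulr_ge0 // hnorm_ge0.
  have Sy : 0 < hnorm (S y) by rewrite lt_neqAle eq_sym Sy0 hnorm_ge0.
  rewrite -(ler_pM2l Sy) -expr2 -rdotxx {1}/rdot -hS -/(rdot _ _) mulrCA mulrA.
  apply: le_trans (ler_norm _) (le_trans (ler_rdot _ _) _).
  by rewrite ler_wpM2r ?hnorm_ge0.
- by move=> S' hS'; exists S' => x y; rewrite hS hS'.
Qed.

Lemma adjP V W (A : bop V W) x y : inner (A x) y = inner x (adj A y).
Proof.
have [S hS] := adj_exists A; rewrite /adj.
exact: (xgetPex (P := [set S : bop W V | forall x y, inner (A x) y = inner x (S y)]) 0
  (ex_intro _ S hS)).
Qed.

Lemma adjPr V W (A : bop V W) x y : inner (adj A y) x = inner y (A x).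
Proof. by rewrite innerC -adjP -innerC. Qed.

Lemma adj_unique V W (A : bop V W) (S : bop W V) :
  (forall x y, inner (A x) y = inner x (S y)) -> adj A = S.
Proof. by move=> h; apply: bopE => y; apply: inner_inj => x; rewrite -adjP h. Qed.

Lemma adjK V W (A : bop V W) : adj (adj A) = A.
Proof. by apply: adj_unique => y x; rewrite adjPr. Qed.

Lemma adj_bound V W (A : bop V W) (c : K) : 0 <= c ->
  (forall x, hnorm (A x) <= c * hnorm x) ->
  forall y, hnorm (adj A y) <= c * hnorm y.
Proof.
move=> c0 hc y; have [->|Sy0] := eqVneq (hnorm (adj A y)) 0.
  by rewrite mulr_ge0 // hnorm_ge0.
have Sy : 0 < hnorm (adj A y) by rewrite lt_neqAle eq_sym Sy0 hnorm_ge0.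
rewrite -(ler_pM2l Sy) -expr2 -rdotxx {1}/rdot -adjP -/(rdot _ _) mulrCA mulrA.
apply: le_trans (ler_norm _) (le_trans (ler_rdot _ _) _).
by rewrite ler_wpM2r ?hnorm_ge0.
Qed.

Lemma adj_contraction V W (A : bop V W) :
  nonexpansive A -> nonexpansive (adj A).
Proof.
move=> h y; rewrite -[leRHS]mul1r; apply: adj_bound => // x.
by rewrite mul1r.
Qed.

(** Polarization: the sesquilinear form of P is determined by its diagonal, which
    is real. *)
Lemma positive_sym V (P : bop V V) : positive_op P ->
  forall x y, inner (P x) y = inner x (P y).
Proof.
move=> P0.
have Im0 x : complex.Im (inner (P x) x) = 0.
  by have := P0 x; rewrite lecE /= => /andP[/eqP].
have ImD (z w : K[i]) : complex.Im (z + w) = complex.Im z + complex.Im w.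
  by case: z; case: w.
have ImS x y : complex.Im (inner (P x) y) = complex.Im (inner x (P y)).
  have := Im0 (x + y); rewrite [P (x + y)]linearD /= linearDl /= !linearDr /= !ImD !Im0.
  rewrite [inner x (P y)]innerC; case: (inner (P y) x) => a b /=; lra.
move=> x y; apply/eqP; rewrite eq_complex ImS eqxx andbT.
have := ImS ('i%C *: x) y; rewrite linearZ /= !linearZl_LR /=.
case: (inner (P x) y) => a b; case: (inner x (P y)) => a' b' /=.
by rewrite !mul0r !mul1r !add0r => ->.
Qed.

Lemma positive_rdot V (P : bop V V) x : positive_op P -> 0 <= rdot (P x) x.
Proof. by move=> /(_ x); rewrite lecE /= => /andP[]. Qed.

Lemma symmetric_positive V (P : bop V V) :
  (forall x y, inner (P x) y = inner x (P y)) ->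
  (forall x, 0 <= rdot (P x) x) -> positive_op P.
Proof.
move=> Ps P0 x; rewrite lecE /= P0 andbT.
have := innerC (P x) x; rewrite -Ps; case: (inner _ _) => a b [] /= bb.
by apply/eqP; lra.
Qed.

Lemma adj_comp_positive V W (A : bop V W) : positive_op (adj A ** A).
Proof. by move=> x /=; rewrite adjPr innerxx lec0C exprn_ge0 // hnorm_ge0. Qed.

(** The operators P + c stand in for the functional calculus of P. *)
Lemma positive_resolvent V (P : bop V V) (c : K) :
  positive_op P -> 0 < c ->
  exists S : bop V V, (forall y, P (S y) + c%:C%C *: S y = y) /\
    (forall x, S (P x + c%:C%C *: x) = x).
Proof.
move=> P0 c0; pose B : bop V V := P + c%:C%C *: bop_id.
have BE x : B x = P x + c%:C%C *: x by [].
have Bc x : c * hnorm x ^+ 2 <= rdot (B x) x.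
  by rewrite BE rdotDl rdotZl rdotxx lerDr positive_rdot.
have /choice [S hS] : forall y, exists v, B v = y.
  move=> y; have [|v hv] := @symmetric_lax_milgram V V B bop_id y c c0 _ Bc.
    move=> x z; rewrite !BE linearDl linearDr /= positive_sym //.
    by rewrite linearZl_LR linearZr_LR /=; congr (_ + _ * _); rewrite [RHS]conjc_real.
  by exists v; apply: inner_inj => x; rewrite -hv.
have Binj x : B x = 0 -> x = 0.
  move=> Bx; apply/hnorm_eq0/eqP; rewrite -sqrf_eq0 eq_le exprn_ge0 ?hnorm_ge0 //.
  by rewrite andbT -(ler_pM2l c0) mulr0 (le_trans (Bc x)) // Bx rdot0l.
have [] := @bop_mk _ _ _ S c^-1.
- move=> a y z; apply/eqP; rewrite -subr_eq0; apply/eqP/Binj.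
  have BP u v : B (a *: u + v) = a *: B u + B v by exact: linearP.
  by rewrite [LHS]linearB -[X in _ - X]/(B _) -[X in X - _]/(B _) BP !hS subrr.
- move=> y; have [->|Sy0] := eqVneq (hnorm (S y)) 0.
    by rewrite mulr_ge0 ?hnorm_ge0 // invr_ge0 ltW.
  have Sy : 0 < hnorm (S y) by rewrite lt_neqAle eq_sym Sy0 hnorm_ge0.
  rewrite mulrC ler_pdivlMr // mulrC -(ler_pM2r Sy) -mulrA -expr2.
  apply: le_trans (Bc _) _; rewrite hS.
  exact: le_trans (ler_norm _) (ler_rdot _ _).
- move=> S' hS'; exists S'; split=> [y|x]; first by rewrite hS' -BE.
  apply/eqP; rewrite -subr_eq0; apply/eqP/Binj.
  by rewrite [LHS]linearB -[X in X - _]/(B _) -BE hS' hS subrr.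
Qed.

End Operators.

Section SquareRoot.
Variable K : realType.
Implicit Types V W : hilbertType K.

(** Identities of the form <Ax, y> = <z, Bw> pass to strong limits. *)
Lemma cvg_inner_eq V W (u : nat -> V) (l : V) (w : nat -> W) (m : W) y z :
  u n @[n --> \oo] --> l -> w n @[n --> \oo] --> m ->
  (forall n, inner (u n) y = inner z (w n)) -> inner l y = inner z m.
Proof.
move=> ul wm uw; apply/eqP; rewrite -subr_eq0; apply/eqP/cabs_eq0.
apply/eqP; rewrite eq_le cabs_ge0 andbT; apply: le0_eps => eps e0.
have d0 : 0 < eps / 2 by rewrite divr_gt0.
near \oo => n.
have -> : inner l y - inner z m = inner (l - u n) y + - inner z (m - w n).
  by rewrite linearBl linearBr /= uw; ring.
apply: le_trans (ler_cabsD _ _) _; rewrite [leRHS]splitr; apply: lerD.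
  by apply: ltW; near: n; exact: cvg_inner.
rewrite /cabs normrN -/(cabs _) innerC cabs_conj.
by apply: ltW; near: n; exact: cvg_inner.
Unshelve. all: by end_near. Qed.

Lemma bop_pointwise_limit V W (A : nat -> bop V W) (c : K) :
  (forall n x, hnorm (A n x) <= c * hnorm x) ->
  (forall x, exists y : W, A n x @[n --> \oo] --> y) ->
  exists L : bop V W, (forall x, A n x @[n --> \oo] --> L x) /\
    (forall x, hnorm (L x) <= c * hnorm x).
Proof.
move=> Ac /choice [Y hY].
have Ylin : linear Y.
  move=> a x y; apply: (cvg_unique _ (hY _)) => //.
  have -> : (fun n => A n (a *: x + y)) = (fun n => a *: A n x + A n y).
    by apply/funext => n; rewrite linearP.
  by apply: cvgD (hY y); apply: cvgZr; exact: hY.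
have Yle x : hnorm (Y x) <= c * hnorm x.
  rewrite -subr_le0; apply: le0_eps => eps /((cvg_hnormP _ _).1 (hY x)) [N _ hN].
  have := hN N (leqnn N); have := Ac N x.
  have := ler_hnormD (Y x - A N x) (A N x); rewrite subrK.
  move: (c * _) (hnorm _) (hnorm _) (hnorm _) => *; lra.
have [S SE] := bop_mk Ylin Yle.
by exists S; split=> x; rewrite SE.
Qed.

(** The square root iteration of positive_sqrt_le1 on the scalar line, for B = 1. *)
Fixpoint sqrt_majorant (n : nat) : K :=
  if n is n'.+1 then (1 + sqrt_majorant n' ^+ 2) / 2 else 0.

Lemma sqrt_majorant_itv n : 0 <= sqrt_majorant n <= 1.
Proof.
elim: n => [|n /andP[h0 h1]] /=; first by rewrite lexx ler01.
by move: h0 h1; move: (sqrt_majorant n) => y *; apply/andP; split; nra.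
Qed.

Lemma sqrt_majorant_le n m : (n <= m)%N -> sqrt_majorant n <= sqrt_majorant m.
Proof.
elim: m n => [|m IH] [|n] //= nm.
  by have /andP[h0 h1] := sqrt_majorant_itv m.+1; exact: h0.
have := IH n nm; have /andP[] := sqrt_majorant_itv n.
have /andP[] := sqrt_majorant_itv m.
by move: (sqrt_majorant n) (sqrt_majorant m) => a b *; nra.
Qed.

Lemma sqrt_majorant_cauchy (eps : K) : 0 < eps ->
  exists N, forall n m, (N <= n)%N -> (n <= m)%N ->
    sqrt_majorant m - sqrt_majorant n < eps.
Proof.
move=> e0; pose E := range sqrt_majorant.
have supE : has_sup E.
  split; first by exists (sqrt_majorant 0), 0%N.
  by exists 1 => _ [n _ <-]; have /andP[] := sqrt_majorant_itv n.
have [_ [N _ <-] hN] := sup_adherent e0 supE.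
exists N => n m Nn nm.
have : sqrt_majorant m <= sup E by apply: sup_upper_bound => //; exists m.
have := sqrt_majorant_le Nn; lra.
Qed.

(** If 0 <= A <= 1 and B = 1 - A, then the iteration Y <- (B + Y^2) / 2 started
    at 0 is dominated, increment by increment, by the scalar iteration in which
    B is replaced by its norm bound 1.  Its limit Y satisfies 2Y = B + Y^2, i.e.
    (1 - Y)^2 = A. *)
Lemma positive_sqrt_le1 V (A : bop V V) : positive_op A ->
  (forall x, rdot (A x) x <= hnorm x ^+ 2) ->
  exists P : bop V V, positive_op P /\ P ** P = A.
Proof.
move=> A0 A1; have [B BE] : exists B : bop V V, forall x, B x = x - A x.
  by exists (bop_id - A).
have Bsym x y : inner (B x) y = inner x (B y).
  by rewrite !BE linearBl linearBr /= positive_sym.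
have B0 : positive_op B.
  apply: symmetric_positive => // x.
  by rewrite BE rdotDl rdotNl rdotxx subr_ge0.
have B1 x : hnorm (B x) <= hnorm x.
  (* Positivity of B at x - Bx gives 2 |Bx|^2 <= <Bx, x> + <BBx, Bx>. *)
  have [->|Bx0] := eqVneq (hnorm (B x)) 0; first exact: hnorm_ge0.
  have Bx : 0 < hnorm (B x) by rewrite lt_neqAle eq_sym Bx0 hnorm_ge0.
  have BS : rdot (B (B x)) x = hnorm (B x) ^+ 2 by rewrite /rdot Bsym innerxx.
  have BB1 : rdot (B (B x)) (B x) <= hnorm (B x) ^+ 2.
    by rewrite BE rdotDl rdotNl rdotxx gerBl positive_rdot.
  have Bxx : rdot (B x) x <= hnorm x ^+ 2.
    by rewrite BE rdotDl rdotNl rdotxx gerBl positive_rdot.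
  have := positive_rdot (x - B x) B0.
  rewrite [B (x - _)]linearB /= !rdotDl !rdotDr !rdotNl !rdotNr BS rdotxx.
  move=> h; rewrite -(ler_pXn2r (n := 2)) ?nnegrE ?hnorm_ge0 //; lra.
pose Yn := fix Yn (n : nat) : bop V V :=
  if n is n'.+1 then (2^-1)%:C%C *: (B + Yn n' ** Yn n') else 0.
have YS n x : Yn n.+1 x = (2^-1)%:C%C *: (B x + Yn n (Yn n x)) by [].
have half0 : (0 : K) <= 2^-1 by rewrite invr_ge0.
have Ysym n x y : inner (Yn n x) y = inner x (Yn n y).
  elim: n x y => [|n IH] x y; first by rewrite linear0l linear0r.
  rewrite !YS linearZl_LR linearZr_LR /= [inner (_ + _) _]linearDl.
  rewrite [inner _ (_ + _)]linearDr /= Bsym !IH; congr (_ * _); by rewrite [RHS]conjc_real.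
have Ybnd n x : hnorm (Yn n x) <= sqrt_majorant n * hnorm x.
  elim: n x => [|n IH] x; first by rewrite mul0r hnorm0.
  have /andP[y0 _] := sqrt_majorant_itv n.
  rewrite YS hnormZ cabsC ger0_norm //= [_ / 2]mulrC -mulrA ler_wpM2l //.
  apply: le_trans (ler_hnormD _ _) _; rewrite mulrDl mul1r lerD //.
  by apply: le_trans (IH _) _; rewrite expr2 -mulrA ler_wpM2l.
have Ystep n x :
    hnorm (Yn n.+1 x - Yn n x) <= (sqrt_majorant n.+1 - sqrt_majorant n) * hnorm x.
  elim: n x => [|n IH] x; first by rewrite !subr0; exact: Ybnd.
  have /andP[y0 _] := sqrt_majorant_itv n.
  have /andP[y1 _] := sqrt_majorant_itv n.+1.
  rewrite !(YS _ x) -scalerBr hnormZ cabsC ger0_norm //.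
  have -> : B x + Yn n.+1 (Yn n.+1 x) - (B x + Yn n (Yn n x)) =
      Yn n.+1 (Yn n.+1 x - Yn n x) + (Yn n.+1 (Yn n x) - Yn n (Yn n x)).
    by rewrite [Yn n.+1 (_ - _)]linearB /= opprD addrACA subrr add0r subrKA.
  have h1 := le_trans (Ybnd n.+1 _) (ler_wpM2l y1 (IH x)).
  have d0 : 0 <= sqrt_majorant n.+1 - sqrt_majorant n.
    by rewrite subr_ge0; exact: sqrt_majorant_le.
  have h2 : hnorm (Yn n.+1 (Yn n x) - Yn n (Yn n x)) <=
      (sqrt_majorant n.+1 - sqrt_majorant n) * (sqrt_majorant n * hnorm x).
    by apply: le_trans (IH _) _; rewrite ler_wpM2l.
  have := ler_hnormD (Yn n.+1 (Yn n.+1 x - Yn n x))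
                     (Yn n.+1 (Yn n x) - Yn n (Yn n x)).
  move: h1 h2; rewrite [sqrt_majorant n.+2]/=.
  have -> : (sqrt_majorant n.+1 : K) = (1 + sqrt_majorant n ^+ 2) / 2 by [].
  move: (hnorm _) (hnorm _) (hnorm _) (hnorm x) (sqrt_majorant n) => *; lra.
have Ydist n m x : (n <= m)%N ->
    hnorm (Yn m x - Yn n x) <= (sqrt_majorant m - sqrt_majorant n) * hnorm x.
  elim: m => [|m IH]; first by case: n => // _; rewrite !subrr hnorm0 mul0r.
  rewrite leq_eqVlt => /orP[/eqP->|]; first by rewrite !subrr hnorm0 mul0r.
  rewrite ltnS => /IH h; rewrite -(subrKA (Yn m x)).
  apply: le_trans (ler_hnormD _ _) _; have := Ystep m x; move: h.
  move: (hnorm x) (hnorm _) (hnorm _) (sqrt_majorant n) (sqrt_majorant m)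
    (sqrt_majorant m.+1) => *; lra.
have Yc x : exists y : V, Yn n x @[n --> \oo] --> y.
  apply: hcauchy_cvg => eps e0.
  have x1 : 0 < hnorm x + 1 by rewrite ltr_wpDl ?hnorm_ge0.
  have [N hN] := sqrt_majorant_cauchy (divr_gt0 e0 x1).
  have h n m : (N <= n)%N -> (n <= m)%N -> hnorm (Yn m x - Yn n x) < eps.
    move=> Nn nm; apply: le_lt_trans (Ydist _ _ x nm) _.
    have := hN _ _ Nn nm; rewrite ltr_pdivlMr // => /(le_lt_trans _); apply.
    rewrite ler_wpM2l ?lerDl // subr_ge0; exact: sqrt_majorant_le.
  exists N => m n Nm Nn; case: (leqP n m) => [|/ltnW] nm; first exact: h.
  by rewrite hdistC; exact: h.
have Y1 n x : hnorm (Yn n x) <= 1 * hnorm x.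
  apply: le_trans (Ybnd n x) _; rewrite ler_wpM2r ?hnorm_ge0 //.
  by have /andP[] := sqrt_majorant_itv n.
have [S [hY S1]] := bop_pointwise_limit Y1 Yc.
have Ssym x y : inner (S x) y = inner x (S y).
  by apply: cvg_inner_eq (hY x) (hY y) _.
have Y2 x : Yn n (Yn n x) @[n --> \oo] --> S (S x).
  apply/cvg_hnormP => eps e0; have d0 : 0 < eps / 2 by rewrite divr_gt0.
  near=> n; rewrite -(subrKA (Yn n (S x))) -linearB /=.
  apply: le_lt_trans (ler_hnormD _ _) _; rewrite [ltRHS]splitr; apply: ltrD.
    by near: n; exact: ((cvg_hnormP _ _).1 (hY _) _ d0).
  apply: le_lt_trans (Ybnd _ _) _.
  apply: (@le_lt_trans _ _ (hnorm (S x - Yn n x))).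
    by rewrite ler_piMl ?hnorm_ge0 //; have /andP[] := sqrt_majorant_itv n.
  by near: n; exact: ((cvg_hnormP _ _).1 (hY _) _ d0).
have SS x : S x = (2^-1)%:C%C *: (B x + S (S x)).
  have h1 : Yn n.+1 x @[n --> \oo] --> S x.
    by rewrite (cvg_shiftS (fun n => Yn n x)); exact: hY.
  apply: (cvg_unique _ h1) => //.
  by apply: cvgZr; apply: cvgD (Y2 x); exact: cvg_cst.
exists (bop_id - S); split.
  apply: symmetric_positive => [x y|x].
    by rewrite !bopB linearBl linearBr /= Ssym.
  rewrite bopB rdotDl rdotNl rdotxx subr_ge0.
  apply: le_trans (ler_norm _) (le_trans (ler_rdot _ _) _).
  by rewrite expr2 ler_wpM2r ?hnorm_ge0 // -[leRHS]mul1r.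
apply: bopE => x; change (x - S x - S (x - S x) = A x).
have h : S x + S x = B x + S (S x).
  by rewrite {1 2}SS -scalerDl -rmorphD /= -div1r -splitr scale1r.
rewrite linearB /= opprB addrACA -opprD h BE.
by rewrite [x - A x + _]addrAC subKr.
Unshelve. all: by end_near. Qed.

Lemma positive_sqrt V (A : bop V V) : positive_op A ->
  exists P : bop V V, positive_op P /\ P ** P = A.
Proof.
move=> A0; have [c0 c00 hc] := bop_bounded A; pose c := c0 + 1.
have c_gt0 : 0 < c by rewrite ltr_wpDl.
have [|x|P [P0 PP]] := @positive_sqrt_le1 V ((c^-1)%:C%C *: A).
- apply: symmetric_positive => [x y|x].
    rewrite !bopZ linearZl_LR linearZr_LR /= positive_sym //.
    by congr (_ * _); rewrite [RHS]conjc_real.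
  by rewrite bopZ rdotZl mulr_ge0 ?positive_rdot // invr_ge0 ltW.
- rewrite bopZ rdotZl mulrC ler_pdivrMr // mulrC.
  apply: le_trans (ler_norm _) (le_trans (ler_rdot _ _) _).
  rewrite expr2 mulrA ler_wpM2r ?hnorm_ge0 // (le_trans (hc x)) //.
  by rewrite ler_wpM2r ?hnorm_ge0 // lerDl.
exists ((Num.sqrt c)%:C%C *: P); split.
  apply: symmetric_positive => [x y|x].
    rewrite !bopZ linearZl_LR linearZr_LR /= positive_sym //.
    by congr (_ * _); rewrite [RHS]conjc_real.
  by rewrite bopZ rdotZl mulr_ge0 ?positive_rdot // sqrtr_ge0.
apply: bopE => x.
change ((Num.sqrt c)%:C%C *: P ((Num.sqrt c)%:C%C *: P x) = A x).
rewrite [P (_ *: _)]linearZ /= scalerA -rmorphM /=.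
rewrite -expr2 sqr_sqrtr ?ltW // -[P (P x)]/((P ** P) x) PP bopZ scalerA.
by rewrite -rmorphM /= divff ?gt_eqF // scale1r.
Qed.

Lemma absopP V W (A : bop V W) :
  positive_op (absop A) /\ absop A ** absop A = adj A ** A.
Proof.
have [P hP] := positive_sqrt (adj_comp_positive A).
exact: (xgetPex (P := [set P : bop V V | positive_op P /\ P ** P = adj A ** A])
  0 (ex_intro _ P hP)).
Qed.

Lemma absop_positive V W (A : bop V W) : positive_op (absop A).
Proof. by case: (absopP A). Qed.

Lemma hnorm_absop V W (A : bop V W) x : hnorm (absop A x) = hnorm (A x).
Proof.
apply/eqP; rewrite -(eqrXn2 (n := 2)) ?hnorm_ge0 // -!rdotxx.
rewrite [rdot (A x) _]/rdot adjP -[adj A (A x)]/((adj A ** A) x) -(absopP A).2.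
by rewrite /rdot positive_sym //; exact: absop_positive.
Qed.

End SquareRoot.

(** * Orthonormal bases and unordered sums *)

Section UnorderedSums.
Variable K : realType.
Local Open Scope ereal_scope.

Lemma esum_leP (I : choiceType) (a : I -> \bar K) (c : \bar K) :
  \esum_(i in setT) a i <= c <->
  forall s : seq I, uniq s -> \sum_(i <- s) a i <= c.
Proof.
split=> [h s us|h].
  apply: le_trans h; apply: esum_ge; exists [set` s]; last by rewrite fsbig_seq.
  by split; first exact: finite_seq.
apply: ge_ereal_sup => _ [A [finA _] <-].
by rewrite fsbig_finite //; apply: h; exact: finmap.fset_uniq.
Qed.

Lemma sum_le_esum (I : choiceType) (a : I -> \bar K) (s : seq I) :
  uniq s -> \sum_(i <- s) a i <= \esum_(i in setT) a i.
Proof. by move=> us; exact: (esum_leP a _).1. Qed.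

Lemma esum_realP (I : choiceType) (a : I -> K) (c : K) :
  \esum_(i in setT) (a i)%:E <= c%:E <->
  forall s : seq I, uniq s -> (\sum_(i <- s) a i <= c)%R.
Proof.
rewrite esum_leP; split=> h s us; have := h s us.
  by rewrite sumEFin lee_fin.
by rewrite sumEFin lee_fin.
Qed.

Lemma exchange_esum (I J : choiceType) (a : I -> J -> \bar K) :
  (forall i j, 0 <= a i j) ->
  \esum_(i in setT) \esum_(j in setT) a i j =
  \esum_(j in setT) \esum_(i in setT) a i j.
Proof.
have ex (X Y : choiceType) (b : X -> Y -> \bar K) : (forall i j, 0 <= b i j) ->
    \esum_(i in setT) \esum_(j in setT) b i j <=
    \esum_(j in setT) \esum_(i in setT) b i j.
  move=> b0; apply/esum_leP => s us; rewrite -esum_sum //.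
  by apply: le_esum => j _; exact: sum_le_esum.
by move=> a0; apply/eqP; rewrite eq_le !ex.
Qed.

End UnorderedSums.

Section Bases.
Variable K : realType.
Implicit Types (V W : hilbertType K) (I : choiceType).

Definition orthonormal_sys V I (f : I -> V) :=
  forall i j, inner (f i) (f j) = (i == j)%:R.

(** Completeness of f, stated with an unordered sum so that double sums of squared
    entries can be exchanged. *)
Definition parseval V I (f : I -> V) := forall x : V,
  (\esum_(i in setT) (cabs (inner x (f i)) ^+ 2)%:E = (hnorm x ^+ 2)%:E)%E.

Lemma orthonormal_hnorm V I (f : I -> V) i : orthonormal_sys f -> hnorm (f i) = 1.
Proof.
move=> of_; apply/eqP; rewrite -(eqrXn2 (n := 2)) ?hnorm_ge0 // expr1n.
by rewrite -rdotxx /rdot of_ eqxx.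
Qed.

Lemma inner_suml V (T : Type) (s : seq T) (F : T -> V) y :
  inner (\sum_(i <- s) F i) y = \sum_(i <- s) inner (F i) y.
Proof.
elim: s => [|i s IH]; first by rewrite !big_nil linear0l.
by rewrite !big_cons linearDl /= IH.
Qed.

Lemma inner_sumr V (T : Type) (s : seq T) (F : T -> V) y :
  inner y (\sum_(i <- s) F i) = \sum_(i <- s) inner y (F i).
Proof.
elim: s => [|i s IH]; first by rewrite !big_nil linear0r.
by rewrite !big_cons linearDr /= IH.
Qed.

Lemma inner_orthonormal_sum V I (f : I -> V) (c : I -> K[i]) (s : seq I) j :
  orthonormal_sys f -> uniq s ->
  inner (\sum_(i <- s) c i *: f i) (f j) = if j \in s then c j else 0.
Proof.
move=> of_ us; rewrite inner_suml.
transitivity (\sum_(i <- s | i == j) c i).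
  rewrite [RHS]big_mkcond; apply: eq_bigr => i _; rewrite linearZl_LR /= of_.
  by case: eqP => _; rewrite ?mulr1 ?mulr0.
case: ifPn => js; last first.
  by rewrite big_seq_cond big_pred0 // => i; case: eqP => [->|]; rewrite ?andbF ?(negPf js).
by rewrite (big_rem j) //= eqxx big_seq_cond big_pred0 ?addr0 // => i;
  case: eqP => [->|]; rewrite ?andbF ?mem_rem_uniq // inE eqxx.
Qed.

Lemma hnorm_orthonormal_sum V I (f : I -> V) (c : I -> K[i]) (s : seq I) :
  orthonormal_sys f -> uniq s ->
  hnorm (\sum_(i <- s) c i *: f i) ^+ 2 = \sum_(i <- s) cabs (c i) ^+ 2.
Proof.
move=> of_ us; apply: complexI; rewrite -innerxx.
rewrite inner_sumr rmorph_sum /= big_seq [RHS]big_seq; apply: eq_bigr => i si.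
rewrite linearZr_LR /= inner_orthonormal_sum // si.
by rewrite -normCKC normc_cabs rmorphXn.
Qed.

Lemma orthonormal_proj_split V I (f : I -> V) (s : seq I) x :
  orthonormal_sys f -> uniq s ->
  hnorm x ^+ 2 = \sum_(i <- s) cabs (inner x (f i)) ^+ 2 +
    hnorm (x - \sum_(i <- s) inner x (f i) *: f i) ^+ 2.
Proof.
move=> of_ us; set p := (X in x - X).
have px : rdot p (x - p) = 0.
  rewrite rdotC /rdot inner_sumr Re_sum big_seq big1 // => i si.
  rewrite linearZr_LR /= linearBl /= inner_orthonormal_sum // si subrr.
  by rewrite mulr0.
rewrite -(hnorm_orthonormal_sum _ of_ us) -/p.
by have := hnormD_sqr p (x - p); rewrite subrKC px mulr0 addr0.
Qed.

Lemma bessel V I (f : I -> V) (s : seq I) x : orthonormal_sys f -> uniq s ->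
  \sum_(i <- s) cabs (inner x (f i)) ^+ 2 <= hnorm x ^+ 2.
Proof.
move=> of_ us; rewrite (orthonormal_proj_split x of_ us) lerDl.
by rewrite exprn_ge0 // hnorm_ge0.
Qed.

Lemma bounded_partial_sums_cauchy (a : nat -> K) (c : K) : (forall k, 0 <= a k) ->
  (forall n, \sum_(k < n) a k <= c) ->
  forall eps, 0 < eps -> exists N, forall n m, (N <= n)%N -> (n <= m)%N ->
    \sum_(n <= k < m) a k < eps.
Proof.
move=> a0 ac eps e0; pose E := range (fun n => \sum_(k < n) a k).
have supE : has_sup E.
  split; first by exists (\sum_(k < 0) a k), 0%N.
  by exists c => _ [n _ <-].
have [_ [N _ <-] hN] := sup_adherent e0 supE.
exists N => n m Nn nm.
have : \sum_(k < m) a k <= sup E by apply: sup_upper_bound => //; exists m.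
have : \sum_(k < N) a k <= \sum_(k < n) a k.
  rewrite -!(big_mkord xpredT) (big_cat_nat (leq0n N) Nn) //= lerDl.
  by apply: sumr_ge0 => k _; exact: a0.
have : \sum_(k < m) a k = \sum_(k < n) a k + \sum_(n <= k < m) a k.
  by rewrite -!(big_mkord xpredT) (big_cat_nat (leq0n n) nm).
by move: hN; move: (sup E) => *; lra.
Qed.

Lemma sum_ordE (U : nmodType) (F : nat -> U) n : \sum_(k < n) F k = \sum_(k <- iota 0 n) F k.
Proof. by rewrite -(big_mkord xpredT) /index_iota subn0. Qed.

(** The Fourier series converges by Bessel; its sum has the coordinates of x, and
    totality identifies the two. *)
Lemma onb_expansion V (e : nat -> V) (x : V) : is_onb e ->
  (fun n => \sum_(k < n) inner x (e k) *: e k) @ \oo --> x.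
Proof.
move=> [oe tot]; pose u n := \sum_(k < n) inner x (e k) *: e k.
have [l ul] : exists l : V, u n @[n --> \oo] --> l.
  have a0 k : 0 <= cabs (inner x (e k)) ^+ 2 by rewrite exprn_ge0 // cabs_ge0.
  have ac n : \sum_(k < n) cabs (inner x (e k)) ^+ 2 <= hnorm x ^+ 2.
    by have := bessel x oe (iota_uniq 0 n); rewrite -sum_ordE.
  apply: hcauchy_cvg => eps e0.
  have [N hN] := bounded_partial_sums_cauchy a0 ac (exprn_gt0 2 e0).
  have h n m : (N <= n)%N -> (n <= m)%N -> hnorm (u m - u n) < eps.
    move=> Nn nm; rewrite -(ltr_pXn2r (n := 2)) ?nnegrE ?hnorm_ge0 ?ltW //.
    rewrite /u -!(big_mkord xpredT (fun k => inner x (e k) *: e k)).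
    rewrite (big_cat_nat (leq0n n) nm) //=; rewrite addrAC subrr add0r.
    by rewrite hnorm_orthonormal_sum ?iota_uniq //; exact: hN.
  exists N => m n Nm Nn; case: (leqP n m) => [|/ltnW] nm; first exact: h.
  by rewrite hdistC; exact: h.
suff lx : x = l by rewrite -lx in ul; exact: ul.
apply/eqP; rewrite -subr_eq0; apply/eqP/tot => k.
apply/cabs_eq0/eqP; rewrite eq_le cabs_ge0 andbT; apply: le0_eps => eps e0.
have [N _ hN] := cvg_inner (e k) ul e0.
pose n := maxn N k.+1.
have := hN n (leq_maxl _ _); rewrite /= !linearBl /= /u.
rewrite (sum_ordE (fun k => inner x (e k) *: e k)).
rewrite inner_orthonormal_sum ?iota_uniq // mem_iota /= add0n leq_maxr.
by move=> /ltW; rewrite -opprB /cabs normrN.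
Qed.

Lemma onb_parseval V (e : nat -> V) : is_onb e -> parseval e.
Proof.
move=> onb x; have oe := onb.1.
apply/eqP; rewrite eq_le; apply/andP; split.
  by apply/esum_realP => s us; exact: bessel.
apply/lee_addgt0Pr => eps e0.
have d0 : 0 < Num.sqrt eps by rewrite sqrtr_gt0.
have [N hN] := (cvg_hnorm_seqP _ _).1 (@onb_expansion _ _ x onb) _ d0.
apply: le_trans (leeD2r _ (sum_le_esum _ (iota_uniq 0 N))).
rewrite sumEFin -EFinD lee_fin.
rewrite (orthonormal_proj_split x oe (iota_uniq 0 N)) lerD2l -sum_ordE.
rewrite -(sqr_sqrtr (ltW e0)) ler_pXn2r ?nnegrE ?hnorm_ge0 ?sqrtr_ge0 //.
by rewrite ltW // hN.
Qed.

Lemma parseval_eq0 V I (f : I -> V) x : parseval f ->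
  (forall i, inner x (f i) = 0) -> x = 0.
Proof.
move=> pf h; apply/hnorm_eq0/eqP; rewrite -sqrf_eq0 -(eqe _ 0) -pf.
by rewrite esum1 // => i _; rewrite h /cabs normr0 expr0n.
Qed.

Lemma parseval_eq V I (f : I -> V) x y : parseval f ->
  (forall i, inner x (f i) = inner y (f i)) -> x = y.
Proof.
move=> pf h; apply/eqP; rewrite -subr_eq0; apply/eqP/(parseval_eq0 pf) => i.
by rewrite linearBl /= h subrr.
Qed.

Lemma bop_eq_on_basis V W I (J : choiceType) (f : I -> V) (g : J -> W) (A B : bop V W) :
  parseval f -> parseval g ->
  (forall i j, inner (A (f i)) (g j) = inner (B (f i)) (g j)) -> A = B.
Proof.
move=> pf pg h; apply: bopE => x; apply: (parseval_eq pg) => j.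
rewrite !adjP innerC [RHS]innerC; congr (Num.conj (inner _ x)).
apply: (parseval_eq pf) => i.
by rewrite innerC [RHS]innerC -!adjP h.
Qed.

Lemma inner_dinj n V (a : 'I_n) (x : V) (u : dsum n V) :
  inner u (dinj a x) = inner (u a) x.
Proof.
change (dsum_inner u (dinj a x) = inner (u a) x).
rewrite /dsum_inner (bigD1 a) //= ffunE eqxx big1 ?addr0 // => b ba.
by rewrite ffunE (negPf ba) linear0r.
Qed.

Lemma dinjE n V (a b : 'I_n) (x : V) :
  (dinj a x : dsum n V) b = if b == a then x else 0.
Proof. by rewrite ffunE. Qed.

Lemma hnorm_dsum n V (u : dsum n V) : hnorm u ^+ 2 = \sum_a hnorm (u a) ^+ 2.
Proof.
apply: complexI; rewrite rmorph_sum /= -innerxx innerE dsum_normE.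
by apply: eq_bigr => a _; rewrite -innerE innerxx.
Qed.

Lemma dsum_basis_orthonormal d V (e : nat -> V) :
  orthonormal_sys e -> orthonormal_sys (dsum_basis d e).
Proof.
move=> oe [a k] [b l]; rewrite /dsum_basis inner_dinj dinjE /= xpair_eqE.
by rewrite eq_sym; case: eqP => _; rewrite ?oe ?linear0l.
Qed.

Lemma dsum_basis_parseval d V (e : nat -> V) :
  orthonormal_sys e -> parseval e -> parseval (dsum_basis d e).
Proof.
move=> oe pe u; have of_ := @dsum_basis_orthonormal d _ _ oe.
apply/eqP; rewrite eq_le; apply/andP; split.
  by apply/esum_realP => s us; exact: bessel.
rewrite hnorm_dsum -sumEFin.
under eq_bigr do rewrite -pe.
rewrite -esum_sum => [|k a _ _]; last by rewrite lee_fin exprn_ge0 // cabs_ge0.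
apply/esum_leP => s us.
apply: le_trans (sum_le_esum _ (s := [seq (a, k) | k <- s, a <- index_enum _]) _).
  rewrite big_allpairs_dep /=; apply: lee_sum => k _; apply: lee_sum => a _.
  by rewrite /dsum_basis inner_dinj.
by apply: allpairs_uniq => //; [exact: index_enum_uniq|move=> [a k] [b l] _ _ [-> ->]].
Qed.

End Bases.

(** * The trace norm as a supremum over nonexpansive operators *)

Section TraceNorm.
Variable K : realType.
Implicit Types (V W : hilbertType K) (I J : choiceType).

Lemma hs_norm2E V W I (f : I -> V) (A : bop V W) :
  hs_norm2 f A = (\esum_(i in setT) (hnorm (A (f i)) ^+ 2)%:E)%E.
Proof. by apply: eq_esum => i _; rewrite Re_normr2. Qed.

(** The Hilbert-Schmidt norms of X U and of its adjoint U^* X^* agree by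
    Tonelli and Parseval, and U^* does not increase norms; Bessel suffices for
    the system f. *)
Lemma hs_norm2_comp_le V W I J (f : I -> V) (g : J -> W)
    (X : bop V W) (U : bop V V) :
  orthonormal_sys f -> parseval g -> nonexpansive U ->
  (hs_norm2 f (X ** U) <= hs_norm2 g (adj X))%E.
Proof.
move=> of_ pg U1; rewrite !hs_norm2E.
under eq_esum do rewrite -pg.
rewrite exchange_esum => [|i j]; last by rewrite lee_fin exprn_ge0 // cabs_ge0.
apply: le_esum => j _; apply/esum_realP => s us.
apply: (@le_trans _ _ (hnorm (adj U (adj X (g j))) ^+ 2)); last first.
  by rewrite ler_pXn2r ?nnegrE ?hnorm_ge0 //; exact: adj_contraction.
apply: le_trans (bessel _ of_ us); apply: ler_sum => i _.
by rewrite [inner (adj U _) _]innerC cabs_conj -!adjP.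
Qed.

Lemma positive_cauchy_schwarz V (P Q : bop V V) x y :
  positive_op Q -> Q ** Q = P ->
  cabs (inner (P x) y) <= (hnorm (Q x) ^+ 2 + hnorm (Q y) ^+ 2) / 2.
Proof.
move=> Q0 <-; rewrite [X in inner X]/= positive_sym //.
apply: le_trans (cabs_inner _ _) _; rewrite ler_pdivlMr //.
by have := sqr_ge0 (hnorm (Q x) - hnorm (Q y)); lra.
Qed.

(** Both directions use K = D (|D| + eps)^-1, which is nonexpansive since
    |Dx| = ||D|x|, as a substitute for the partial isometry of the polar
    decomposition: D = K (|D| + eps), and K^* D differs from |D| by at most eps.
    Thus U = K recovers Tr |D|; conversely <Df, Uf> is up to eps the value of the
    positive form |D| at (f, K^* U f), to be compared with Tr |D| by means of
    the square root of |D|. *)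
Lemma trace_norm_leP V I (f : I -> V) (D : bop V V) (c : K) :
  orthonormal_sys f -> parseval f ->
  (trace_norm f D <= c%:E)%E <->
  (forall (U : bop V V) (s : seq I), nonexpansive U -> uniq s ->
    \sum_(i <- s) cabs (inner (D (f i)) (U (f i))) <= c).
Proof.
move=> of_ pf; set P := absop D; have P0 : positive_op P := absop_positive D.
have PD x : hnorm (P x) = hnorm (D x) := hnorm_absop D x.
have PP x y : inner (D x) (D y) = inner (P x) (P y).
  rewrite adjP -[adj D _]/((adj D ** D) y) -(absopP D).2 /=.
  by rewrite -positive_sym.
have f1 i := orthonormal_hnorm i of_.
have fdiag i : 0 <= rdot (P (f i)) (f i) := positive_rdot _ P0.
have trP : trace_norm f D = (\esum_(i in setT) (rdot (P (f i)) (f i))%:E)%E by [].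
have resolv eps : 0 < eps -> exists S L : bop V V, [/\ nonexpansive L,
    forall x, L x = D (S x), forall y, P (S y) + eps%:C%C *: S y = y &
    forall x, S (P x + eps%:C%C *: x) = x].
  move=> e0; have [S [S1 S2]] := positive_resolvent P0 e0.
  exists S, (D ** S); split=> // y.
  rewrite /= -PD -(ler_pXn2r (n := 2)) ?nnegrE ?hnorm_ge0 //.
  rewrite -{2}(S1 y) hnormD_sqr rdotZr.
  have := positive_rdot (S y) P0; have := sqr_ge0 (hnorm (eps%:C%C *: S y)).
  move: (rdot _ _) (hnorm _ ^+ 2) (hnorm _ ^+ 2) => a b b' *; nra.
have sum_eps (s : seq I) (F : I -> K) :
    (forall eps, 0 < eps -> exists2 G : I -> K,
       forall i, F i <= G i + eps & \sum_(i <- s) G i <= c) ->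
    \sum_(i <- s) F i <= c.
  move=> FG; apply/ler_addgt0Pr => eps e0.
  have n0 : 0 < (size s).+1%:R :> K by [].
  have [G FG1 Gc] := FG _ (divr_gt0 e0 n0).
  apply: le_trans (ler_sum _ (fun i _ => FG1 i)) _.
  rewrite big_split /= lerD // big_const_seq count_predT iter_addr_0.
  by rewrite -[_ *+ _]mulr_natr -mulrAC ler_pdivrMr // ler_pM2l // ler_nat.
split=> [trc U s U1 us|h]; last first.
  rewrite trP; apply/esum_realP => s us; apply: sum_eps => eps e0.
  have [S [L [L1 LE S1 _]]] := resolv _ e0.
  exists (fun i => cabs (inner (D (f i)) (L (f i)))); last exact: h.
  move=> i; apply: le_trans (_ : rdot (D (f i)) (L (f i)) + eps <= _); last first.
    by rewrite lerD2r Re_le_cabs.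
  rewrite {2}/rdot LE PP -/(rdot _ _).
  have PS : P (S (f i)) = f i - eps%:C%C *: S (f i).
    by rewrite -{2}(S1 (f i)) addrK.
  have PS1 : rdot (P (f i)) (S (f i)) <= 1.
    rewrite /rdot positive_sym // -/(rdot _ _).
    apply: le_trans (ler_norm _) (le_trans (ler_rdot _ _) _).
    by rewrite f1 mul1r PD -LE (le_trans (L1 _)) // f1.
  rewrite PS rdotDr rdotNr rdotZr -addrA lerDl addrC subr_ge0.
  by rewrite ler_piMr // ltW.
have [Q [Q0 QQ]] := positive_sqrt P0.
have Qf x : hnorm (Q x) ^+ 2 = rdot (P x) x.
  by rewrite -rdotxx -QQ /rdot /= [in RHS]positive_sym.
have hsQ : (hs_norm2 f Q <= c%:E)%E.
  by rewrite hs_norm2E; apply: le_trans trc; apply: le_esum => i _; rewrite Qf.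
have adjQ : adj Q = Q by apply: adj_unique => x y; rewrite positive_sym.
apply: sum_eps => eps e0; have [S [L [L1 LE _ S2]]] := resolv _ e0.
pose w := adj L ** U.
have w1 : nonexpansive w.
  by move=> x; apply: le_trans (adj_contraction L1 _) (U1 x).
exists (fun i => (hnorm (Q (f i)) ^+ 2 + hnorm (Q (w (f i))) ^+ 2) / 2).
  move=> i.
  have -> : D (f i) = L (P (f i) + eps%:C%C *: f i) by rewrite LE S2.
  rewrite adjP -[adj L _]/(w (f i)) linearDl /= linearZl_LR.
  apply: le_trans (ler_cabsD _ _) _; apply: lerD.
    exact: positive_cauchy_schwarz.
  rewrite cabsM cabsC (ger0_norm (ltW e0)) ler_piMr ?(ltW e0) //.
  apply: le_trans (cabs_inner _ _) _; rewrite f1 mul1r.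
  by rewrite (le_trans (w1 _)) // f1.
rewrite -mulr_suml ler_pdivrMr // big_split mulrDr mulr1 /=.
apply: lerD; first by move: s us; apply/esum_realP; rewrite -hs_norm2E.
move: s us; apply/esum_realP; rewrite -(hs_norm2E f (Q ** w)).
by apply: le_trans (hs_norm2_comp_le Q of_ pf w1) _; rewrite adjQ.
Qed.

Lemma trace_norm_ge0 V I (f : I -> V) (D : bop V V) : (0 <= trace_norm f D)%E.
Proof.
by apply: esum_ge0 => i _; rewrite lee_fin positive_rdot //; exact: absop_positive.
Qed.

Lemma trace_norm_triangle V I (f : I -> V) (A B : bop V V) (a b : K) :
  orthonormal_sys f -> parseval f ->
  (trace_norm f A <= a%:E)%E -> (trace_norm f B <= b%:E)%E ->
  (trace_norm f (A + B)%R <= (a + b)%:E)%E.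
Proof.
move=> of_ pf /(trace_norm_leP _ _ of_ pf) hA /(trace_norm_leP _ _ of_ pf) hB.
apply/trace_norm_leP => // U s U1 us.
apply: le_trans (lerD (hA U s U1 us) (hB U s U1 us)); rewrite -big_split /=.
by apply: ler_sum => i _; rewrite linearDl /= ler_cabsD.
Qed.

(** Take for U the rank one operator sending f_i to f_j. *)
Lemma inner_le_trace_norm V I (f : I -> V) (D : bop V V) (c : K) i j :
  orthonormal_sys f -> parseval f -> (trace_norm f D <= c%:E)%E ->
  cabs (inner (D (f i)) (f j)) <= c.
Proof.
move=> of_ pf /(trace_norm_leP _ _ of_ pf) h.
have := h (rank1 (f j) (f i)) [:: i] _ isT; rewrite big_seq1 /=.
rewrite of_ eqxx scale1r; apply=> x /=; rewrite hnormZ orthonormal_hnorm // mulr1.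
by rewrite (le_trans (cabs_inner _ _)) // orthonormal_hnorm // mulr1.
Qed.

Lemma sum_diag_le_trace_norm V I (f : I -> V) (D : bop V V) (c : K) (s : seq I) :
  orthonormal_sys f -> parseval f -> (trace_norm f D <= c%:E)%E -> uniq s ->
  \sum_(i <- s) cabs (inner (D (f i)) (f i)) <= c.
Proof.
move=> of_ pf /(trace_norm_leP _ _ of_ pf) h us.
by apply: (h bop_id s _ us) => x /=.
Qed.

(** The Cauchy-Schwarz inequality for the Hilbert-Schmidt norm, weighted so that
    a small factor can be balanced against a bounded one. *)
Lemma trace_norm_adj_comp V W I J (f : I -> V) (g : J -> W) (X Y : bop V W)
    (a b t : K) :
  orthonormal_sys f -> parseval f -> parseval g -> 0 < t ->
  (hs_norm2 g (adj X) <= a%:E)%E -> (hs_norm2 f Y <= b%:E)%E ->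
  (trace_norm f (adj X ** Y) <= ((t * a + t^-1 * b) / 2)%:E)%E.
Proof.
move=> of_ pf pg t0 Xa Yb; apply/trace_norm_leP => // U s U1 us.
have hX : \sum_(i <- s) hnorm (X (U (f i))) ^+ 2 <= a.
  move: s us; apply/esum_realP; rewrite -(hs_norm2E f (X ** U)).
  exact: le_trans (hs_norm2_comp_le X of_ pg U1) Xa.
have hY : \sum_(i <- s) hnorm (Y (f i)) ^+ 2 <= b.
  by move: s us {hX}; apply/esum_realP; rewrite -hs_norm2E.
apply: (@le_trans _ _ (\sum_(i <- s)
    (t * hnorm (X (U (f i))) ^+ 2 + t^-1 * hnorm (Y (f i)) ^+ 2) / 2)); last first.
  rewrite -mulr_suml ler_pM2r // big_split -!mulr_sumr /=.
  by rewrite lerD // ler_pM2l // invr_gt0.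
apply: ler_sum => i _; rewrite /= adjPr.
apply: le_trans (cabs_inner _ _) _; rewrite ler_pdivlMr //.
move: (hnorm _) (hnorm _) => x y.
have -> : t * x ^+ 2 + t^-1 * y ^+ 2 = t^-1 * ((t * x - y) ^+ 2) + y * x * 2.
  by field; rewrite gt_eqF.
by rewrite lerDr mulr_ge0 ?sqr_ge0 // invr_ge0 ltW.
Qed.

End TraceNorm.

Section TraceTopology.
Variables (K : realType) (I : choiceType) (V : hilbertType K) (f : I -> V).
Hypothesis of_ : orthonormal_sys f.
Hypothesis pf : parseval f.

Lemma trace_norm_lt (A : bop V V) (c : K) : (trace_norm f A < c%:E)%E ->
  exists2 b : K, (trace_norm f A <= b%:E)%E & b < c.
Proof.
move: (trace_norm_ge0 f A); case: (trace_norm f A) => [b| |] //.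
by rewrite lte_fin => _ bc; exists b.
Qed.

(** The open sets are defined by inclusion of balls, so that balls are open only
    by virtue of the triangle inequality. *)
Lemma trace_ball_open (L : bop V V) (c : K) :
  open ([set A | (trace_norm f (A - L)%R < c%:E)%E] : set (trace_space f)).
Proof.
move=> A /= /trace_norm_lt [b Ab bc]; exists (c - b); first by rewrite subr_gt0.
move=> A' /= /trace_norm_lt [b' A'b' bc'].
have -> : A' - L = (A' - A) + (A - L) by rewrite subrKA.
apply: le_lt_trans (trace_norm_triangle of_ pf A'b' Ab) _.
by rewrite lte_fin -ltrBrDr.
Qed.

Lemma trace_norm0 : trace_norm f (0 : bop V V) = 0%E.
Proof.
apply/eqP; rewrite eq_le trace_norm_ge0 andbT.
apply/trace_norm_leP => // U s _ _.
by rewrite big1 // => i _; rewrite linear0l /cabs normr0.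
Qed.

Lemma trace_ball_nbhs (L : bop V V) (c : K) : 0 < c ->
  nbhs (L : trace_space f) [set A | (trace_norm f (A - L)%R < c%:E)%E].
Proof.
move=> c0; apply: open_nbhs_nbhs; split; first exact: trace_ball_open.
by rewrite /= subrr trace_norm0 lte_fin.
Qed.

Lemma trace_nbhsP (L : bop V V) (U : set (trace_space f)) :
  nbhs (L : trace_space f) U -> exists2 c : K, 0 < c &
    forall A : bop V V, (trace_norm f (A - L)%R < c%:E)%E -> U A.
Proof.
rewrite nbhsE => -[W [oW WL] WU]; have [c c0 h] := oW L WL.
by exists c => // A hA; apply/WU/h.
Qed.

End TraceTopology.

(** * The strong-* topology and the ball *)

Lemma initial_cvgP (S : choiceType) (T : topologicalType) (f : S -> T)
    (X : Type) (F : set_system X) (FF : Filter F) (u : X -> initial_topology f)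
    (s : initial_topology f) :
  u @ F --> s <-> (f \o u) @ F --> f s.
Proof.
split=> [us|fus A [_ [[C oC <-] Cs] CA]].
  exact: continuous_cvg (@initial_continuous S T f s) us.
have : nbhs (f s) C by apply: open_nbhs_nbhs; split.
by move=> /fus; apply: (@filterS _ F _ (fun x => C (f (u x)))) => x; exact: CA.
Qed.

Lemma ptws_cvgP (I : Type) (T : topologicalType)
    (X : Type) (F : set_system X) (FF : Filter F) (u : X -> {ptws I -> T})
    (s : {ptws I -> T}) :
  u @ F --> s <-> forall i, (fun x => u x i) @ F --> s i.
Proof.
rewrite cvg_sup; split=> h i; have := h i.
  by move/(initial_cvgP _).
by move=> hi; apply/initial_cvgP.
Qed.

Section StrongStarBall.
Variables (K : realType) (H : hilbertType K) (d : nat).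
Implicit Types T : optuple H d.

Lemma strong_star_cvgP (X : Type) (F : set_system X) (FF : Filter F)
    (u : X -> optuple H d) T :
  u @ F --> T <-> forall j x, (fun t => u t j x) @ F --> T j x /\
    (fun t => adj (u t j) x) @ F --> adj (T j) x.
Proof.
split=> [/initial_cvgP/ptws_cvgP h j x|h].
  have {}h := h (j, x); split.
    exact: cvg_comp h (@cvg_fst _ _ _ _ _).
  exact: cvg_comp h (@cvg_snd _ _ _ _ _).
apply/initial_cvgP/ptws_cvgP => -[j x] /=.
by have [h1 h2] := h j x; apply: cvg_pair.
Qed.

Lemma opnorm_leP (V W : hilbertType K) (A : bop V W) (M : K) :
  (opnorm A <= M%:E)%E <-> 0 <= M /\ forall x, hnorm (A x) <= M * hnorm x.
Proof.
split=> [h|[M0 h]]; last first.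
  apply: ge_ereal_sup => _ [x /= x1 <-]; rewrite lee_fin.
  apply: le_trans (h x) _; rewrite ler_piMr //.
  by rewrite -lecC -normr_hnorm.
have hM x : hnorm x <= 1 -> hnorm (A x) <= M.
  move=> x1; rewrite -lee_fin; apply: le_trans h; apply: ereal_sup_ubound.
  by exists x => //=; rewrite normr_hnorm -[1]/(1%:C%C) lecC.
split=> [|x].
  by have := hM 0; rewrite linear0 !hnorm0; apply; exact: ler01.
have [/hnorm_eq0 ->|x0] := eqVneq (hnorm x) 0.
  by rewrite linear0 !hnorm0 mulr0.
have xg : 0 < hnorm x by rewrite lt_neqAle eq_sym x0 hnorm_ge0.
have := hM ((hnorm x)^-1%:C%C *: x).
rewrite linearZ /= !hnormZ cabsC ger0_norm ?invr_ge0 ?hnorm_ge0 // mulVf //.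
by rewrite mulrC ler_pdivrMr // mulrC => ->.
Qed.

Lemma opballP T M : opball H d M T <->
  forall j, 0 <= M /\ forall x, hnorm (T j x) <= M * hnorm x.
Proof. by split=> h j; apply/opnorm_leP; exact: h. Qed.

End StrongStarBall.

(** * Dominated convergence for series *)

Lemma cvg_finite_sum (L : numFieldType) (W : normedModType L) (X : Type)
    (F : set_system X) (FF : Filter F) (I : Type) (s : seq I) (P : pred I)
    (g : I -> X -> W) (l : I -> W) :
  (forall i, P i -> g i t @[t --> F] --> l i) ->
  \sum_(i <- s | P i) g i t @[t --> F] --> \sum_(i <- s | P i) l i.
Proof.
move=> gl; elim: s => [|i s IH].
  by rewrite big_nil; under eq_cvg do rewrite big_nil; exact: cvg_cst.
rewrite big_cons; under eq_cvg do rewrite big_cons.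
by case: ifP => [/gl Pi|_] //; exact: cvgD.
Qed.

Section Series.
Variable K : realType.

Lemma esum_natP (a : nat -> K) (c : K) : (forall k, 0 <= a k) ->
  (\esum_(k in setT) (a k)%:E <= c%:E)%E <-> forall n, \sum_(k < n) a k <= c.
Proof.
move=> a0; rewrite esum_realP; split=> [h n|h s us].
  by rewrite sum_ordE h // iota_uniq.
pose n := (\max_(k <- s) k).+1.
apply: le_trans (h n); rewrite sum_ordE.
have sn : {subset s <= iota 0 n}.
  by move=> k ks; rewrite mem_iota /= add0n ltnS; exact: leq_bigmax_seq.
have ps : perm_eq s [seq k <- iota 0 n | k \in s].
  apply: uniq_perm => //; first by rewrite filter_uniq // iota_uniq.
  by move=> k; rewrite mem_filter; case: (boolP (k \in s)) => // /sn ->.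
rewrite (perm_big _ ps) big_filter big_mkcond; apply: ler_sum => k _.
by case: ifP.
Qed.

(** The tail of the dominating series is small, and its finitely many first terms
    are handled by termwise convergence. *)
Lemma dominated_sums (X : Type) (F : set_system X) {FF : Filter F}
    (w : X -> nat -> K) (c : nat -> K) (C : K) :
  (forall k, 0 <= c k) -> (forall n, \sum_(k < n) c k <= C) ->
  (\forall t \near F, forall k, 0 <= w t k <= c k) ->
  (forall k eps, 0 < eps -> \forall t \near F, w t k <= eps) ->
  forall eps, 0 < eps -> \forall t \near F, forall n, \sum_(k < n) w t k <= eps.
Proof.
move=> c0 cC wc w0 eps e0; have e20 : 0 < eps / 2 by rewrite divr_gt0.
have [m hm] := bounded_partial_sums_cauchy c0 cC e20.
have m0 : 0 < m.+1%:R :> K by [].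
have wm : \forall t \near F, forall k : 'I_m, w t k <= eps / 2 / m.+1%:R.
  by apply: filter_forall => k; apply: w0; rewrite divr_gt0.
near=> t => n.
have wct : forall k, 0 <= w t k <= c k by near: t.
have wmt : forall k : 'I_m, w t k <= eps / 2 / m.+1%:R by near: t.
have hw : \sum_(k < m) w t k <= eps / 2.
  apply: le_trans (ler_sum _ (fun k _ => wmt k)) _.
  rewrite sumr_const card_ord -[_ *+ _]mulr_natr mulrAC ler_pdivrMr // ler_pM2l //.
  by rewrite ler_nat.
apply: le_trans (_ : \sum_(k < maxn m n) w t k <= _).
  rewrite -!(big_mkord xpredT) [leRHS](big_cat_nat (leq0n n)) ?leq_maxr //= lerDl.
  by apply: sumr_ge0 => k _; have /andP[] := wct k.
rewrite -(big_mkord xpredT) (big_cat_nat (leq0n m)) ?leq_maxl //= big_mkord.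
rewrite [leRHS]splitr; apply: lerD => //; apply: ltW.
apply: le_lt_trans (hm m (maxn m n) _ _) => //; last exact: leq_maxl.
by apply: ler_sum => k _; have /andP[] := wct k.
Unshelve. all: by end_near. Qed.

Lemma esum_dominated (g c : nat -> K) (C : K) :
  (forall k, 0 <= g k <= c k) -> (forall n, \sum_(k < n) c k <= C) ->
  exists S : K, [/\ (\esum_(k in setT) (g k)%:E = S%:E)%E, 0 <= S & S <= C].
Proof.
move=> gc cC; have g0 k : 0 <= g k by have /andP[] := gc k.
have gC : (\esum_(k in setT) (g k)%:E <= C%:E)%E.
  apply/(esum_natP _ g0) => n; apply: le_trans (cC n).
  by apply: ler_sum => k _; have /andP[] := gc k.
have S0 : (0 <= \esum_(k in setT) (g k)%:E)%E.
  by apply: esum_ge0 => k _; rewrite lee_fin.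
case: (\esum_(k in setT) _)%E gC S0 => [S| |] //; rewrite !lee_fin => SC S0.
by exists S.
Qed.

Lemma dominated_esum (X : Type) (F : set_system X) {FF : Filter F}
    (g : X -> nat -> K) (g0 c : nat -> K) (S : X -> K) (S0 C : K) :
  (forall k, 0 <= g0 k <= c k) -> (forall n, \sum_(k < n) c k <= C) ->
  (forall t k, 0 <= g t k <= c k) ->
  (forall k eps, 0 < eps -> \forall t \near F, `|g t k - g0 k| <= eps) ->
  (forall t, \esum_(k in setT) (g t k)%:E = (S t)%:E)%E ->
  (\esum_(k in setT) (g0 k)%:E = S0%:E)%E ->
  forall eps, 0 < eps -> \forall t \near F, `|S t - S0| <= eps.
Proof.
move=> g0c cC gc gg0 SE S0E eps e0.
have gp t k : 0 <= g t k by have /andP[] := gc t k.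
have g0p k : 0 <= g0 k by have /andP[] := g0c k.
have SP t n : \sum_(k < n) g t k <= S t.
  by move: n; apply/(esum_natP _ (gp t)); rewrite SE.
have S0P n : \sum_(k < n) g0 k <= S0.
  by move: n; apply/(esum_natP _ g0p); rewrite S0E.
have : \forall t \near F, forall n, \sum_(k < n) `|g t k - g0 k| <= eps.
  apply: (@dominated_sums _ F _ (fun t k => `|g t k - g0 k|) c C) => //.
    by move=> k; have /andP[h1 h2] := g0c k; exact: le_trans h2.
  apply: nearW => t k; rewrite normr_ge0 ler_norml.
  by have /andP[] := gc t k; have /andP[] := g0c k; lra.
apply: filterS => t ht; rewrite ler_norml; apply/andP; split.
  rewrite lerBrDr addrC -lerBrDr opprK -lee_fin -S0E.
  apply/(esum_natP _ g0p) => n; apply: le_trans (lerD (SP t n) (ht n)).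
  rewrite -big_split /=; apply: ler_sum => k _; rewrite -lerBlDl distrC.
  exact: ler_norm.
rewrite lerBlDl -lee_fin -SE.
apply/(esum_natP _ (gp t)) => n; apply: le_trans (lerD (S0P n) (ht n)).
by rewrite -big_split /=; apply: ler_sum => k _; rewrite -lerBlDl ler_norm.
Qed.

Lemma ecvg_squeeze (f : nat -> \bar K) (s : K) :
  (forall eps, 0 < eps -> exists N0, forall N, (N0 <= N)%N ->
    ((s - eps)%:E <= f N <= (s + eps)%:E)%E) ->
  f N @[N --> \oo] --> s%:E.
Proof.
move=> h; apply/fine_cvgP; split.
  have [N0 hN0] := h 1 ltr01; exists N0 => // N /= /hN0.
  by case: (f N) => // /andP[].
apply/cvgrPdist_le => eps e0; have [N0 hN0] := h eps e0.
exists N0 => // N /= /hN0; case: (f N) => [x| |] /andP[] //=.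
by rewrite !lee_fin ler_norml; lra.
Qed.

(** If S n N decreases to 0 in N for each n, then a limit in n followed by one
    in N can be replaced by a supremum over n followed by a limit in N: for N
    large the terms with n large are controlled by the first limit, and the
    finitely many remaining ones are small. *)
Lemma dini_sup (S : nat -> nat -> K) (S0 : nat -> K) :
  (forall n N, 0 <= S n N) ->
  (forall n N N', (N <= N')%N -> S n N' <= S n N) ->
  (forall N eps, 0 < eps -> \forall n \near \oo, `|S n N - S0 N| <= eps) ->
  (forall n eps, 0 < eps -> exists N, S n N <= eps) ->
  exists s : K, [/\ (S0 N)%:E @[N --> \oo] --> s%:E,
    ereal_sup [set (S n N)%:E | n in setT] @[N --> \oo] --> s%:E,
    forall N, 0 <= s <= S0 N &
    forall eps, 0 < eps -> exists N, S0 N <= s + eps].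
Proof.
move=> Sp Smono SS0 Sz.
have S0p N : 0 <= S0 N.
  rewrite -oppr_le0; apply: le0_eps => eps /(SS0 N) [n _ /(_ n (leqnn n))].
  by have := Sp n N; rewrite ler_norml => h /andP[]; lra.
have S0mono N N' : (N <= N')%N -> S0 N' <= S0 N.
  move=> NN'; rewrite -subr_le0; apply: le0_eps => eps e0.
  have e20 : 0 < eps / 2 by rewrite divr_gt0.
  have [n1 _ h1] := SS0 N _ e20; have [n2 _ h2] := SS0 N' _ e20.
  have := h1 _ (leq_maxl n1 n2); have := h2 _ (leq_maxr n1 n2).
  have := Smono (maxn n1 n2) _ _ NN'; rewrite !ler_norml.
  by move=> h /andP[] ? ? /andP[]; lra.
pose E := range S0.
have infE : has_inf E.
  split; first by exists (S0 0), 0%N.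
  by exists 0 => _ [N _ <-].
pose s := inf E.
have sS0 N : s <= S0 N by apply: ge_inf; [exact: infE.2|exists N].
have s0 : 0 <= s by apply: lb_le_inf; [exact: infE.1|move=> _ [N _ <-]].
have near_s eps : 0 < eps -> exists N, S0 N <= s + eps.
  move=> e0; have [_ [N _ <-] h] := inf_adherent e0 infE.
  by exists N; exact: ltW.
exists s; split=> // [||N]; last by rewrite s0 sS0.
- apply: ecvg_squeeze => eps e0; have [N0 hN0] := near_s _ e0.
  exists N0 => N N0N; rewrite !lee_fin; have := sS0 N; have := S0mono _ _ N0N.
  by move=> *; apply/andP; split; lra.
apply: ecvg_squeeze => eps e0; have e20 : 0 < eps / 2 by rewrite divr_gt0.
have [N0 hN0] := near_s _ e20; have [n0 _ hn0] := SS0 N0 _ e20.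
have /choice [Nz hNz] : forall n, exists N, S n N <= eps by move=> n; exact: Sz.
exists (maxn N0 (\max_(n < n0) Nz n)) => N; rewrite geq_max => /andP[N0N Nzn].
apply/andP; split.
  have [n1 _ hn1] := SS0 N _ e0.
  apply: (@le_trans _ _ (S n1 N)%:E); last by apply: ereal_sup_ubound; exists n1.
  rewrite lee_fin; have := hn1 n1 (leqnn _); have := sS0 N.
  by rewrite ler_norml => h /andP[]; lra.
apply: ge_ereal_sup => _ [n _ <-]; rewrite lee_fin.
case: (ltnP n n0) => nn0.
  have Nn : (Nz n <= N)%N.
    exact: leq_trans (leq_bigmax (Ordinal nn0)) Nzn.
  by have := hNz n; have := Smono n _ _ Nn; move: s0; lra.
have := hn0 n nn0; have := Smono n _ _ N0N.
by rewrite ler_norml => h /andP[]; lra.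
Qed.

End Series.

(** * The defect of a block operator *)

Section Defect.
Variables (K : realType) (H : hilbertType K).
Variables (e : nat -> H) (r : nat -> K) (R : bop H H) (d : nat) (M : K).
Hypothesis e_onb : is_onb e.
Hypothesis R_pos : positive_op R.
Hypothesis R_inj : injective R.
Hypothesis R_hs : hs_norm2 e R = 1%E.
Hypothesis R_diag : forall k, R (e k) = (r k)%:C%C *: e k.
Hypothesis d_gt0 : (0 < d)%N.

Local Notation f := (dsum_basis d e).
Local Notation op := (bop (dsum (d + d).+1 H) (dsum (d + d).+1 H)).
Implicit Types (T : optuple H d) (G : op) (a : 'I_(d + d).+1).

Let oe : orthonormal_sys e := e_onb.1.
Let pe : parseval e := onb_parseval e_onb.

Lemma eigenvalue_neq0 k : r k != 0.
Proof.
apply/eqP => rk; have /R_inj ek : R (e k) = R 0.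
  by rewrite R_diag rk scale0r linear0.
have := orthonormal_hnorm k oe; rewrite ek hnorm0 => /eqP.
by rewrite eq_sym oner_eq0.
Qed.

Lemma hnorm_R_basis k : hnorm (R (e k)) ^+ 2 = r k ^+ 2.
Proof.
by rewrite R_diag hnormZ cabsC orthonormal_hnorm // mulr1 real_normK ?num_real.
Qed.

Lemma sum_eigenvalues n : \sum_(k < n) r k ^+ 2 <= 1.
Proof.
move: n; apply/(esum_natP _ (fun k => sqr_ge0 (r k))).
rewrite -R_hs hs_norm2E.
by under [leRHS]eq_esum do rewrite hnorm_R_basis.
Qed.

Lemma Aop0 T : Aop T ord0 = bop_id.
Proof. by rewrite /Aop unlift_none. Qed.

Lemma Aop_left T (j : 'I_d) : Aop T (lift ord0 (lshift d j)) = T j.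
Proof. by rewrite /Aop liftK (unsplitK (inl j)). Qed.

Lemma Aop_right T (j : 'I_d) : Aop T (lift ord0 (rshift d j)) = adj (T j).
Proof. by rewrite /Aop liftK (unsplitK (inr j)). Qed.

Lemma Aop_ind (P : bop H H -> Prop) T :
  (forall j, P (T j)) -> (forall j, P (adj (T j))) ->
  forall a, a != ord0 -> P (Aop T a).
Proof.
move=> P1 P2 a; rewrite /Aop eq_sym; case: unliftP => [i _|->].
  by case: (fintype.split i).
by rewrite eqxx.
Qed.

Lemma ball_ge0 T : opball H d M T -> 0 <= M.
Proof. by move=> /opballP/(_ (Ordinal d_gt0))[]. Qed.

Lemma hnorm_Aop T a x : opball H d M T -> a != ord0 ->
  hnorm (Aop T a x) <= M * hnorm x.
Proof.
move=> BT a0; move: x; have M0 := ball_ge0 BT.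
apply: (Aop_ind (P := fun A : bop H H => forall x, hnorm (A x) <= M * hnorm x)) a0.
  by move=> j; exact: ((opballP _ _).1 BT j).2.
by move=> j; apply: adj_bound => //; exact: ((opballP _ _).1 BT j).2.
Qed.

Lemma Brow_dinj T a x : Brow R T (dinj a x) = Aop T a (R x).
Proof.
rewrite /Brow bop_sum (bigD1 a) //= big1 ?addr0 => [|b ba].
  by rewrite ffunE eqxx.
by rewrite ffunE (negPf ba) !linear0.
Qed.

Lemma inner_Qop T a k b l :
  inner (Qop R T (f (a, k))) (f (b, l)) =
  inner (Aop T a (R (e k))) (Aop T b (R (e l))).
Proof. by rewrite /Qop /= adjPr /dsum_basis !Brow_dinj. Qed.

Lemma Pop_proj N x : (bop_id - Pop e N) x =
  x - \sum_(l <- iota 0 N) inner x (e l) *: e l.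
Proof.
rewrite bopB /Pop bop_sum; congr (_ - _).
exact: (sum_ordE (fun l => inner x (e l) *: e l)).
Qed.

Lemma inner_Pop N x l :
  inner ((bop_id - Pop e N) x) (e l) = if (l < N)%N then 0 else inner x (e l).
Proof.
rewrite Pop_proj linearBl /= inner_orthonormal_sum ?iota_uniq // mem_iota /=.
by rewrite add0n; case: ifP; rewrite ?subrr ?subr0.
Qed.

(** For G = Q(T) the sum of the diagonal terms over k and a is Tr H(T), that of
    the correction terms is Tr P_N H(T). *)
Definition qdiag G a k : K := complex.Re (inner (G (f (a, k))) (f (a, k))).

Definition qcorr G N a k : K :=
  \sum_(l < N) ((r l)^-1 * cabs (inner (G (f (a, k))) (f (ord0, nat_of_ord l)))) ^+ 2.

Definition defect G N k : K :=
  \sum_(a | a != ord0) (qdiag G a k - qcorr G N a k).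

Lemma qdiag_Qop T a k : qdiag (Qop R T) a k = hnorm (Aop T a (R (e k))) ^+ 2.
Proof. by rewrite /qdiag inner_Qop innerxx. Qed.

Lemma qcorr_Qop T N a k : qcorr (Qop R T) N a k =
  \sum_(l < N) cabs (inner (Aop T a (R (e k))) (e l)) ^+ 2.
Proof.
apply: eq_bigr => l _; rewrite inner_Qop Aop0 /= (R_diag l) linearZr_LR /= cabsM.
by rewrite cabs_conj cabsC exprMn exprMn real_normK ?num_real // mulrA -exprMn
  mulVf ?eigenvalue_neq0 // expr1n mul1r.
Qed.

Lemma qdefect_Qop T N a k : qdiag (Qop R T) a k - qcorr (Qop R T) N a k =
  hnorm ((bop_id - Pop e N) (Aop T a (R (e k)))) ^+ 2.
Proof.
rewrite qdiag_Qop qcorr_Qop Pop_proj.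
rewrite (orthonormal_proj_split _ oe (iota_uniq 0 N)).
by rewrite (sum_ordE (fun l => cabs (inner _ (e l)) ^+ 2)) addrC addKr.
Qed.

(** Properties of the operators Q(T), T in the ball, which are inherited by their
    coordinatewise limits, and which make the series defining s_N converge. *)
Definition admissible G := forall a k, a != ord0 ->
  [/\ complex.Im (inner (G (f (a, k))) (f (a, k))) = 0,
      forall N, qcorr G N a k <= qdiag G a k &
      qdiag G a k <= M ^+ 2 * r k ^+ 2].

Lemma Qop_admissible T : opball H d M T -> admissible (Qop R T).
Proof.
move=> BT a k a0; split=> [|N|].
- by rewrite inner_Qop innerxx.
- by rewrite -subr_ge0 qdefect_Qop exprn_ge0 // hnorm_ge0.
rewrite qdiag_Qop -hnorm_R_basis -exprMn ler_pXn2r ?nnegrE ?hnorm_ge0 //.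
  exact: hnorm_Aop.
by rewrite mulr_ge0 ?hnorm_ge0 // (ball_ge0 BT).
Qed.

(** Entrywise convergence, the only consequence of trace-norm convergence used in
    the study of the limits of s_N and h_N. *)
Definition coord_cvg (X : Type) (F : set_system X) (D : X -> op) G :=
  forall p q,
  cabs (inner (D t (f p)) (f q) - inner (G (f p)) (f q)) @[t --> F] --> (0 : K).

Section CoordLimits.
Variables (X : Type) (F : set_system X).
Context {FF : Filter F}.
Variables (D : X -> op) (G : op).
Hypothesis DG : coord_cvg F D G.

Lemma cvg_cabs_coord p q :
  cabs (inner (D t (f p)) (f q)) @[t --> F] --> cabs (inner (G (f p)) (f q)).
Proof.
apply/cvgrPdist_le => eps e0.
have /cvgrPdist_le/(_ _ e0) := DG (p : _) q; apply: filterS => t.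
rewrite sub0r normrN (ger0_norm (cabs_ge0 _)); apply: le_trans.
have h (z w : K[i]) : cabs z - cabs w <= cabs (z - w).
  by rewrite lerBlDr -{1}(subrK w z) ler_cabsD.
rewrite distrC ler_norml h andbT lerNl opprB.
by apply: le_trans (h _ _) _; rewrite -opprB /cabs normrN.
Qed.

Lemma cvg_Re_coord p q :
  complex.Re (inner (D t (f p)) (f q)) @[t --> F] -->
  complex.Re (inner (G (f p)) (f q)).
Proof.
apply/cvgrPdist_le => eps e0.
have /cvgrPdist_le/(_ _ e0) := DG (p : _) q; apply: filterS => t.
rewrite sub0r normrN (ger0_norm (cabs_ge0 _)); apply: le_trans.
by rewrite distrC -ReN -ReD ler_norm_Re.
Qed.

Lemma cvg_Im_coord p q :
  complex.Im (inner (D t (f p)) (f q)) @[t --> F] -->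
  complex.Im (inner (G (f p)) (f q)).
Proof.
apply/cvgrPdist_le => eps e0.
have /cvgrPdist_le/(_ _ e0) := DG (p : _) q; apply: filterS => t.
rewrite sub0r normrN (ger0_norm (cabs_ge0 _)); apply: le_trans.
rewrite distrC; set z := inner _ _; set w := inner _ _.
have -> : complex.Im z - complex.Im w = complex.Im (z - w) by case: z; case: w.
rewrite -(ler_pXn2r (n := 2)) ?nnegrE ?cabs_ge0 // cabs_sqr.
by rewrite real_normK ?num_real // lerDr sqr_ge0.
Qed.

Lemma cvg_qcorr N a k : qcorr (D t) N a k @[t --> F] --> qcorr G N a k.
Proof.
apply: cvg_finite_sum => l _; rewrite expr2; under eq_cvg do rewrite expr2.
have h : (r l)^-1 * cabs (inner (D t (f (a, k))) (f (ord0, nat_of_ord l)))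
    @[t --> F] --> (r l)^-1 * cabs (inner (G (f (a, k))) (f (ord0, nat_of_ord l))).
  by apply: cvgM; [exact: cvg_cst|exact: cvg_cabs_coord].
by apply: cvgM.
Qed.

Lemma cvg_defect N k : defect (D t) N k @[t --> F] --> defect G N k.
Proof.
apply: cvg_finite_sum => a _.
by apply: cvgB; [exact: cvg_Re_coord|exact: cvg_qcorr].
Qed.

End CoordLimits.

Arguments cvg_Re_coord {X F FF D G} DG p q.
Arguments cvg_Im_coord {X F FF D G} DG p q.
Arguments cvg_qcorr {X F FF D G} DG N a k.
Arguments cvg_defect {X F FF D G} DG N k.

Lemma admissible_limit (X : Type) (F : set_system X) {FF : ProperFilter F}
    (D : X -> op) G :
  coord_cvg F D G -> (forall t, admissible (D t)) -> admissible G.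
Proof.
move=> DG aD a k a0; split=> [|N|].
- have E t : complex.Im (inner (D t (f (a, k))) (f (a, k))) = 0.
    by have [] := aD t a k a0.
  apply/eqP; rewrite eq_le; apply/andP; split.
    by apply: cvgr_to_le (cvg_Im_coord DG (a, k) (a, k)) _; apply: nearW => t; rewrite E.
  by apply: cvgr_to_ge (cvg_Im_coord DG (a, k) (a, k)) _; apply: nearW => t; rewrite E.
- rewrite -subr_ge0.
  apply: cvgr_to_ge (cvgB (cvg_Re_coord DG (a, k) (a, k)) (cvg_qcorr DG N a k)) _.
  by apply: nearW => t; rewrite subr_ge0; have [_ h _] := aD t a k a0; exact: h.
- apply: cvgr_to_le (cvg_Re_coord DG (a, k) (a, k)) _.
  by apply: nearW => t; have [] := aD t a k a0.
Qed.

Definition defect_bound : K := (\sum_(a < (d + d).+1 | a != ord0) M ^+ 2).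

Lemma defect_itv G N k : admissible G ->
  0 <= defect G N k <= defect_bound * r k ^+ 2.
Proof.
move=> aG; apply/andP; split.
  by apply: sumr_ge0 => a a0; rewrite subr_ge0; have [] := aG a k a0.
rewrite mulr_suml; apply: ler_sum => a a0; have [_ _] := aG a k a0.
apply: le_trans; rewrite gerBl; apply: sumr_ge0 => l _; exact: sqr_ge0.
Qed.

Lemma sum_defect_bound n : \sum_(k < n) defect_bound * r k ^+ 2 <= defect_bound.
Proof.
rewrite -mulr_sumr ler_piMr ?sum_eigenvalues //.
by apply: sumr_ge0 => a _; exact: sqr_ge0.
Qed.

Definition defect_sum G N : K := fine (\esum_(k in setT) (defect G N k)%:E).

Lemma defect_sumE G N : admissible G ->
  (\esum_(k in setT) (defect G N k)%:E = (defect_sum G N)%:E)%E.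
Proof.
move=> aG; rewrite /defect_sum.
have [S [-> _ _]] := esum_dominated (fun k => defect_itv N k aG) sum_defect_bound.
by [].
Qed.

Lemma defect_sum_ge0 G N : admissible G -> 0 <= defect_sum G N.
Proof.
move=> aG; rewrite -lee_fin -defect_sumE //; apply: esum_ge0 => k _.
by rewrite lee_fin; have /andP[] := defect_itv N k aG.
Qed.

Lemma defect_sum_mono G N N' : admissible G -> (N <= N')%N ->
  defect_sum G N' <= defect_sum G N.
Proof.
move=> aG NN'; rewrite -lee_fin -!defect_sumE //; apply: le_esum => k _.
rewrite lee_fin; apply: ler_sum => a _; rewrite lerB //.
have E n : qcorr G n a k = \sum_(0 <= l < n)
    ((r l)^-1 * cabs (inner (G (f (a, k))) (f (ord0, l)))) ^+ 2.
  by rewrite big_mkord.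
rewrite !E [leRHS](big_cat_nat (leq0n N)) //= lerDl.
by apply: sumr_ge0 => l _; exact: sqr_ge0.
Qed.

Lemma cvg_defect_sum (X : Type) (F : set_system X) {FF : Filter F}
    (D : X -> op) G N :
  coord_cvg F D G -> (forall t, admissible (D t)) -> admissible G ->
  forall eps, 0 < eps -> \forall t \near F,
    `|defect_sum (D t) N - defect_sum G N| <= eps.
Proof.
move=> DG aD aG.
apply: (@dominated_esum _ _ F _ (fun t => defect (D t) N) (defect G N)
  (fun k => defect_bound * r k ^+ 2) _ _ defect_bound).
- by move=> k; exact: defect_itv.
- exact: sum_defect_bound.
- by move=> t k; exact: defect_itv.
- move=> k eps e0.
  have /cvgrPdist_le/(_ _ e0) : defect (D t) N k @[t --> F] --> defect G N k.
    exact: cvg_defect.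
  by apply: filterS => t; rewrite distrC.
- by move=> t; exact: defect_sumE.
- exact: defect_sumE.
Qed.

Lemma optrace_esum (A : bop H H) (u : nat -> K) (S : K) :
  (forall k, 0 <= u k) -> (forall k, inner (A (e k)) (e k) = (u k)%:C%C) ->
  (\esum_(k in setT) (u k)%:E = S%:E)%E -> optrace e A = S%:C%C.
Proof.
move=> u0 Au uS; rewrite /optrace.
have uS' n : \sum_(k < n) u k <= S by move: n; apply/(esum_natP _ u0); rewrite uS.
apply: (@cvg_lim K[i]^o); first exact: norm_hausdorff.
apply/(@cvgrPdist_lt _ K[i]^o) => eps eps0.
have epsE : eps = (complex.Re eps)%:C%C by rewrite RRe_real // gtr0_real.
have e0 : 0 < complex.Re eps by rewrite -ltc0C -epsE.
have [N hN] : exists N, S - complex.Re eps < \sum_(k < N) u k.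
  apply: contrapT => /forallNP h.
  have : (\esum_(k in setT) (u k)%:E <= (S - complex.Re eps)%:E)%E.
    by apply/(esum_natP _ u0) => n; rewrite leNgt; apply/negP/h.
  by rewrite uS lee_fin; lra.
exists N => // n /= Nn.
have -> : \sum_(k < n) inner (A (e k)) (e k) = (\sum_(k < n) u k)%:C%C.
  by rewrite rmorph_sum; apply: eq_bigr => k _; exact: Au.
rewrite -rmorphB epsE normc_cabs ltcC cabsC ger0_norm ?subr_ge0 //.
have : \sum_(k < N) u k <= \sum_(k < n) u k.
  rewrite -!(big_mkord xpredT) [leRHS](big_cat_nat (leq0n N)) //= lerDl.
  exact: sumr_ge0.
lra.
Qed.

Lemma hnorm_Dop N x :
  hnorm (Dop e r N x) ^+ 2 = \sum_(l < N) ((r l)^-1 * cabs (inner x (e l))) ^+ 2.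
Proof.
have -> : Dop e r N x = \sum_(l < N) ((r l)^-1%:C%C * inner x (e l)) *: e l.
  by rewrite /Dop bop_sum; apply: eq_bigr => l _; rewrite bopZ /= scalerA.
rewrite (sum_ordE (fun l => ((r l)^-1%:C%C * inner x (e l)) *: e l)).
rewrite hnorm_orthonormal_sum ?iota_uniq //.
rewrite -(sum_ordE (fun l => cabs ((r l)^-1%:C%C * inner x (e l)) ^+ 2)).
by apply: eq_bigr => l _; rewrite cabsM cabsC !exprMn real_normK ?num_real.
Qed.

Lemma s_defect_sum G N : admissible G -> s_ e r G N = (defect_sum G N)%:E.
Proof.
move=> aG; rewrite -defect_sumE //.
under [RHS]eq_esum do rewrite -sumEFin.
rewrite esum_sum => [|k a _ a0]; last first.
  by rewrite lee_fin subr_ge0; have [_ h _] := aG a k a0.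
apply: eq_bigr => a a0.
have cC n : \sum_(k < n) M ^+ 2 * r k ^+ 2 <= M ^+ 2.
  by rewrite -mulr_sumr ler_piMr ?sqr_ge0 ?sum_eigenvalues.
have v0 k : 0 <= qcorr G N a k by apply: sumr_ge0 => l _; exact: sqr_ge0.
have u0 k : 0 <= qdiag G a k.
  by apply: le_trans (v0 k) _; have [_ h _] := aG a k a0.
have [U [UE U0 _]] : exists S : K,
    [/\ (\esum_(k in setT) (qdiag G a k)%:E = S%:E)%E, 0 <= S & S <= M ^+ 2].
  apply: (esum_dominated (c := fun k => M ^+ 2 * r k ^+ 2)) cC => k; rewrite u0 /=.
  by have [_ _] := aG a k a0.
have [V [VE V0 _]] : exists S : K,
    [/\ (\esum_(k in setT) (qcorr G N a k)%:E = S%:E)%E, 0 <= S & S <= M ^+ 2].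
  apply: (esum_dominated (c := fun k => M ^+ 2 * r k ^+ 2)) cC => k; rewrite v0 /=.
  by have [_ h1 h2] := aG a k a0; exact: le_trans (h1 N) h2.
have -> : optrace e (block G a a) = U%:C%C.
  apply: optrace_esum UE => // k; rewrite /block /= -inner_dinj.
  have [Im0 _ _] := aG a k a0; move: Im0; rewrite /qdiag /dsum_basis /=.
  by case: (inner _ _) => x y /= ->.
have -> : hs_norm2 e (Dop e r N ** block G ord0 a) = V%:E.
  rewrite hs_norm2E -VE; apply: eq_esum => k _; congr (_%:E).
  rewrite [LHS]hnorm_Dop; apply: eq_bigr => l _.
  by rewrite /block /= -inner_dinj.
have addE : (\esum_(k in setT) (qdiag G a k - qcorr G N a k)%:E + V%:E = U%:E)%E.
  rewrite -VE -UE -esumD => [|k _|k _]; last by rewrite lee_fin.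
    by apply: eq_esum => k _; rewrite -EFinD subrK.
  by rewrite lee_fin subr_ge0; have [_ h _] := aG a k a0.
by rewrite -[complex.Re _]/U -addE addeK.
Qed.

Lemma inner_Hop T k :
  inner (Hop R T (e k)) (e k) =
  (\sum_(a | a != ord0) hnorm (R (adj (Aop T a) (e k))) ^+ 2)%:C%C.
Proof.
rewrite /Hop bop_sum rmorph_sum /=.
rewrite -big_filter inner_suml big_filter; apply: eq_bigr => a _ /=.
by rewrite adjP positive_sym // innerxx.
Qed.

(** Tonelli: the trace of (I - P_N) H(T) is computed from the squared entries
    |<A_a R e_k, e_l>|^2 with l >= N, which the defect collects by columns. *)
Lemma defect_sum_tail T N : opball H d M T ->
  (\esum_(l in setT) (if (l < N)%N then 0
     else complex.Re (inner (Hop R T (e l)) (e l)))%:E =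
   (defect_sum (Qop R T) N)%:E)%E.
Proof.
move=> BT; have aQ := Qop_admissible BT.
rewrite -defect_sumE //.
under [RHS]eq_esum do rewrite -sumEFin.
rewrite esum_sum => [|k a _ a0]; last first.
  by rewrite lee_fin qdefect_Qop // sqr_ge0.
have -> : (\esum_(l in setT) (if (l < N)%N then 0%R
      else complex.Re (inner (Hop R T (e l)) (e l)))%:E =
    \sum_(a < (d + d).+1 | a != ord0) \esum_(l in setT) (if (l < N)%N then 0%R
      else hnorm (R (adj (Aop T a) (e l))) ^+ 2)%:E)%E.
  rewrite -esum_sum => [|l a _ _]; last by rewrite lee_fin; case: ifP => //; rewrite sqr_ge0.
  apply: eq_esum => l _; rewrite sumEFin inner_Hop; congr (_%:E).
  by case: ifP => // _; rewrite big1.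
apply: eq_bigr => a _.
under [RHS]eq_esum do rewrite qdefect_Qop // -pe.
rewrite exchange_esum => [|k l]; last by rewrite lee_fin sqr_ge0.
apply: eq_esum => l _; case: ifPn => lN.
  rewrite esum1 // => k _; rewrite inner_Pop lN /cabs normr0 expr0n.
  by [].
rewrite -pe; apply: eq_esum => k _; congr ((_ ^+ 2)%:E).
rewrite inner_Pop (negPf lN) [in RHS]adjP [in LHS]positive_sym // innerC.
by rewrite cabs_conj.
Qed.

Lemma h_defect_sum T N : opball H d M T -> h_ e R T N = defect_sum (Qop R T) N.
Proof.
move=> BT; rewrite /h_ (optrace_esum _ _ (defect_sum_tail N BT)) // => k.
  case: ifP => // _; rewrite inner_Hop /=.
  by apply: sumr_ge0 => a _; exact: sqr_ge0.
change (inner ((bop_id - Pop e N) (Hop R T (e k))) (e k) =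
  (if (k < N)%N then 0 else complex.Re (inner (Hop R T (e k)) (e k)))%:C%C).
by rewrite inner_Pop; case: ifP => // _; rewrite inner_Hop.
Qed.

(** * Limits of sequences of tuples *)

Lemma defect_term_le T N a k : opball H d M T -> a != ord0 ->
  hnorm ((bop_id - Pop e N) (Aop T a (R (e k)))) ^+ 2 <= defect_sum (Qop R T) N.
Proof.
move=> BT a0; have aQ := Qop_admissible BT.
rewrite -lee_fin -defect_sumE //; apply: le_trans (sum_le_esum _ (isT : uniq [:: k])).
rewrite big_seq1 lee_fin -qdefect_Qop // /defect (bigD1 a) //= lerDl.
by apply: sumr_ge0 => b _; rewrite qdefect_Qop // sqr_ge0.
Qed.

Lemma cvg_Pop x : hnorm ((bop_id - Pop e N) x) @[N --> \oo] --> (0 : K).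
Proof.
apply/cvgrPdist_lt => eps e0.
have [N hN] := (cvg_hnorm_seqP _ _).1 (@onb_expansion _ _ _ x e_onb) _ e0.
exists N => // n /hN; rewrite (sum_ordE (fun l => inner x (e l) *: e l)) -Pop_proj.
by move=> h; rewrite /= sub0r normrN ger0_norm ?hnorm_ge0.
Qed.

(** Each (I - P_N) A_a R e_k tends to 0, and the convergence is dominated. *)
Lemma defect_sum_Qop_small T eps : opball H d M T -> 0 < eps ->
  exists N, defect_sum (Qop R T) N <= eps.
Proof.
move=> BT e0; have aQ := Qop_admissible BT.
have b0 : 0 <= defect_bound by apply: sumr_ge0 => a _; exact: sqr_ge0.
have z0 : (\esum_(k in [set: nat]) (0%R : K)%:E = 0%:E)%E by rewrite esum1.
suff [N _ hN] : \forall N \near \oo, `|defect_sum (Qop R T) N - 0| <= eps.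
  by exists N; have := hN N (leqnn N); rewrite /= subr0; exact: le_trans (ler_norm _).
move: e0; apply: (@dominated_esum K _ \oo _ (fun N => defect (Qop R T) N)
  (fun=> 0) (fun k => defect_bound * r k ^+ 2) _ 0 defect_bound).
- by move=> k; rewrite lexx mulr_ge0 ?sqr_ge0.
- exact: sum_defect_bound.
- by move=> N k; exact: defect_itv.
- move=> k eta eta0.
  have h : defect (Qop R T) N k @[N --> \oo] -->
      \sum_(a < (d + d).+1 | a != ord0) ((0 : K) * 0).
    apply: cvg_finite_sum => a _.
    have -> : (fun N => qdiag (Qop R T) a k - qcorr (Qop R T) N a k) =
       (fun N => hnorm ((bop_id - Pop e N) (Aop T a (R (e k)))) *
                 hnorm ((bop_id - Pop e N) (Aop T a (R (e k))))).
      by apply/funext => N; rewrite qdefect_Qop.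
    by apply: cvgM; exact: cvg_Pop.
  rewrite mulr0 big1 // in h; move/cvgrPdist_le : h => /(_ _ eta0).
  by apply: filterS => N; rewrite distrC.
- by move=> N; exact: defect_sumE.
- exact: z0.
Qed.

(** The coordinates of A_a R e_k converge, and the defect bounds the part of
    A_a R e_k beyond the first N of them. *)
Lemma coord_cvg_cauchy (T : nat -> optuple H d) G a k :
  (forall n, opball H d M (T n)) -> coord_cvg \oo (fun n => Qop R (T n)) G ->
  (forall eps, 0 < eps -> exists N, \forall n \near \oo,
     defect_sum (Qop R (T n)) N <= eps) ->
  a != ord0 ->
  exists y : H, Aop (T n) a (R (e k)) @[n --> \oo] --> y.
Proof.
move=> BT QG small a0; pose w n := Aop (T n) a (R (e k)).
pose g l := ((r l)^-1)%:C%C * inner (G (f (a, k))) (f (ord0, l)).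
have wg n l : cabs (inner (w n) (e l) - g l) = `|(r l)^-1| *
    cabs (inner (Qop R (T n) (f (a, k))) (f (ord0, l)) -
          inner (G (f (a, k))) (f (ord0, l))).
  rewrite inner_Qop Aop0 /= (R_diag l) linearZr_LR /= -cabsC -cabsM mulrBr.
  congr (cabs (_ - _)); rewrite mulrA -[X in X * _]/(_ * Num.conj _).
  have -> : Num.conj (r l)%:C%C = (r l)%:C%C :> K[i] by exact: conjc_real.
  by rewrite -rmorphM /= mulVf ?eigenvalue_neq0 // mul1r.
(* The squared distance of two late terms is at most 8 eta: by
   |x - y|^2 <= 2 |x|^2 + 2 |y|^2, the first N coordinates and the remaining ones
   contribute 4 eta each. *)
apply: hcauchy_cvg => eps e0; pose eta := eps ^+ 2 / 9.
have eta0 : 0 < eta by rewrite divr_gt0 // exprn_gt0.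
have [N hN] := small _ eta0.
have h : \sum_(l < N) cabs (inner (w n) (e l) - g l) * cabs (inner (w n) (e l) - g l)
    @[n --> \oo] --> \sum_(l < N) ((0 : K) * 0).
  apply: cvg_finite_sum => l _.
  have h : cabs (inner (w n) (e l) - g l) @[n --> \oo] --> (0 : K).
    have -> : (fun n => cabs (inner (w n) (e l) - g l)) = (fun n => `|(r l)^-1| *
        cabs (inner (Qop R (T n) (f (a, k))) (f (ord0, nat_of_ord l)) -
          inner (G (f (a, k))) (f (ord0, nat_of_ord l)))).
      by apply/funext => n; rewrite wg.
    have := @cvgM K nat \oo _ (cst `|(r l)^-1|) _ _ _ (cvg_cst _)
      (QG (a, k) (ord0, nat_of_ord l)).
    by rewrite mulr0 => h; exact: (h _ _).
  by apply: cvgM.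
rewrite mulr0 big1 // in h; move/cvgrPdist_le : h => /(_ _ eta0) [n1 _ h1].
have [n2 _ h2] := hN.
have part n : (maxn n1 n2 <= n)%N ->
    \sum_(l <- iota 0 N) cabs (inner (w n) (e l) - g l) ^+ 2 <= eta /\
    hnorm ((bop_id - Pop e N) (w n)) ^+ 2 <= eta.
  rewrite geq_max => /andP[n1n n2n]; split.
    rewrite -(sum_ordE (fun l => cabs (inner (w n) (e l) - g l) ^+ 2)).
    have := h1 n n1n; rewrite /= sub0r normrN; apply: le_trans.
    by apply: le_trans (ler_norm _); apply: ler_sum => l _; rewrite expr2.
  exact: le_trans (defect_term_le _ _ (BT n) a0) (h2 n n2n).
exists (maxn n1 n2) => m n /part [m1 m2] /part [p1 p2].
rewrite -(ltr_pXn2r (n := 2)) ?nnegrE ?hnorm_ge0 ?ltW //.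
rewrite (orthonormal_proj_split _ oe (iota_uniq 0 N)) -Pop_proj.
have q1 : hnorm ((bop_id - Pop e N) (w m - w n)) ^+ 2 <= 4 * eta.
  have -> : (bop_id - Pop e N) (w m - w n) =
      (bop_id - Pop e N) (w m) - (bop_id - Pop e N) (w n) by exact: linearB.
  move: m2 p2; move: ((bop_id - Pop e N) (w m)) ((bop_id - Pop e N) (w n)) => x y.
  have := hnormD_sqr x (- y); have := hnormD_sqr x y; rewrite hnormN rdotNr.
  have := sqr_ge0 (hnorm (x + y)); lra.
have q2 : \sum_(l <- iota 0 N) cabs (inner (w m - w n) (e l)) ^+ 2 <= 4 * eta.
  apply: (@le_trans _ _ (\sum_(l <- iota 0 N)
    (2 * cabs (inner (w m) (e l) - g l) ^+ 2 +
     2 * cabs (inner (w n) (e l) - g l) ^+ 2))).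
    apply: ler_sum => l _; rewrite linearBl /=.
    have -> : inner (w m) (e l) - inner (w n) (e l) =
      (inner (w m) (e l) - g l) - (inner (w n) (e l) - g l) by ring.
    move: (inner _ _ - _) (inner _ _ - _) => z z'; rewrite !cabs_sqr.
    case: z => x y; case: z' => x' y' /=.
    have := sqr_ge0 (x + x'); have := sqr_ge0 (y + y'); lra.
  by rewrite big_split -!mulr_sumr /=; lra.
have : 0 < eps ^+ 2 by rewrite exprn_gt0.
by move: q1 q2; rewrite /eta; lra.
Qed.

(** Strong convergence of a bounded sequence need only be checked on a total set:
    approximate x by a partial sum of its expansion. *)
Lemma bop_cvg_of_basis (A : nat -> bop H H) (c : K) : 0 <= c ->
  (forall n x, hnorm (A n x) <= c * hnorm x) ->
  (forall k, exists y : H, A n (e k) @[n --> \oo] --> y) ->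
  forall x, exists y : H, A n x @[n --> \oo] --> y.
Proof.
move=> c0 Ac /choice [y hy] x; apply: hcauchy_cvg => eps e0.
have d0 : 0 < eps / 4 / (c + 1) by rewrite !divr_gt0 // ltr_wpDl.
have [m hm] := (cvg_hnorm_seqP _ _).1 (@onb_expansion _ _ _ x e_onb) _ d0.
pose p := \sum_(k < m) inner x (e k) *: e k.
have Ap : A n p @[n --> \oo] --> \sum_(k < m) inner x (e k) *: y k.
  rewrite /p; elim: (m) => [|j IH].
    by rewrite !big_ord0; under eq_cvg do rewrite linear0; exact: cvg_cst.
  rewrite !big_ord_recr /=; under eq_cvg do rewrite linearD linearZ /=.
  by apply: cvgD => //; apply: cvgZr; exact: hy.
have e40 : 0 < eps / 4 by rewrite divr_gt0.
have [N hN] := (cvg_hnorm_seqP _ _).1 Ap _ e40.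
have xp n : hnorm (A n x - A n p) <= eps / 4.
  rewrite -linearB; apply: le_trans (Ac _ _) _.
  have := hm m (leqnn m); rewrite -/p => h.
  have c1 : 0 < c + 1 by rewrite ltr_wpDl.
  have := hnorm_ge0 (x - p).
  move: h; rewrite ltr_pdivlMr //; move: (hnorm _) => u *; nra.
exists N => n n' /hN hn /hN hn'.
have -> : A n x - A n' x = (A n x - A n p) - (A n' x - A n' p)
   + ((\sum_(k < m) inner x (e k) *: y k - A n' p)
   - (\sum_(k < m) inner x (e k) *: y k - A n p)).
  have E (u v z : H) : (z - u) - (z - v) = v - u by rewrite opprB addrC subrKA.
  by rewrite E opprB addrAC !subrKA.
apply: le_lt_trans (ler_hnormD _ _) _.
have := ler_hnormD (A n x - A n p) (- (A n' x - A n' p)).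
have := ler_hnormD (\sum_(k < m) inner x (e k) *: y k - A n' p)
  (- (\sum_(k < m) inner x (e k) *: y k - A n p)).
rewrite !hnormN; have := xp n; have := xp n'; lra.
Qed.

Lemma lift_neq0 (j : 'I_(d + d)) : lift ord0 j != ord0.
Proof. by rewrite eq_sym neq_lift. Qed.

(** The limit of each A_a exists by boundedness and convergence on the basis; the
    limits of T_j and of its adjoint are adjoint to each other. *)
Lemma strong_limit (T : nat -> optuple H d) G :
  (forall n, opball H d M (T n)) -> coord_cvg \oo (fun n => Qop R (T n)) G ->
  (forall eps, 0 < eps -> exists N, \forall n \near \oo,
     defect_sum (Qop R (T n)) N <= eps) ->
  exists2 T0, opball H d M T0 & T @ \oo --> T0.
Proof.
move=> BT QG small; have M0 := ball_ge0 (BT 0).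
have /choice [L hL] : forall a, exists L : bop H H, a != ord0 ->
    (forall x, Aop (T n) a x @[n --> \oo] --> L x) /\
    (forall x, hnorm (L x) <= M * hnorm x).
  move=> a; have [->|a0] := eqVneq a ord0; first by exists 0.
  have Abnd n x : hnorm (Aop (T n) a x) <= M * hnorm x by exact: hnorm_Aop.
  have [|L hL] := bop_pointwise_limit Abnd; last by exists L.
  apply: bop_cvg_of_basis M0 Abnd _ => k.
  have [y hy] := coord_cvg_cauchy k BT QG small a0.
  exists ((r k)^-1%:C%C *: y).
  have -> : (fun n => Aop (T n) a (e k)) =
      (fun n => (r k)^-1%:C%C *: Aop (T n) a (R (e k))).
    apply/funext => n; rewrite R_diag linearZ /= scalerA -rmorphM /=.
    by rewrite mulVf ?eigenvalue_neq0 // scale1r.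
  by apply: cvgZr.
pose T0 : optuple H d := fun j => L (lift ord0 (lshift d j)).
have T0adj j : adj (T0 j) = L (lift ord0 (rshift d j)).
  apply: adj_unique => x y.
  have [hl _] := hL _ (lift_neq0 (lshift d j)).
  have [hr _] := hL _ (lift_neq0 (rshift d j)).
  apply: cvg_inner_eq (hl x) (hr y) _ => n.
  by rewrite Aop_left Aop_right adjP.
exists T0.
  by apply/opballP => j; split=> //; have [] := hL _ (lift_neq0 (lshift d j)).
apply/strong_star_cvgP => j x; rewrite T0adj /T0; split.
  have [h _] := hL _ (lift_neq0 (lshift d j)); have := h x.
  by under eq_cvg do rewrite Aop_left.
have [h _] := hL _ (lift_neq0 (rshift d j)); have := h x.
by under eq_cvg do rewrite Aop_right.
Qed.

Lemma coord_cvg_unique (X : Type) (F : set_system X) {FF : ProperFilter F}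
    (D : X -> op) G G' : coord_cvg F D G -> coord_cvg F D G' -> G = G'.
Proof.
move=> DG DG'; have pf := @dsum_basis_parseval _ d _ _ oe pe.
apply: (bop_eq_on_basis pf pf) => p q.
apply/eqP; rewrite -subr_eq0; apply/eqP/cabs_eq0.
apply/eqP; rewrite eq_le cabs_ge0 andbT; apply: le0_eps => eps e0.
have e20 : 0 < eps / 2 by rewrite divr_gt0.
have /cvgrPdist_lt/(_ _ e20) h1 := DG p q.
have /cvgrPdist_lt/(_ _ e20) h2 := DG' p q.
have [t [/= t1 t2]] := filter_ex (filterI h1 h2).
move: t1 t2; rewrite !sub0r !normrN !ger0_norm ?cabs_ge0 // => t1 t2.
have -> : inner (G (f p)) (f q) - inner (G' (f p)) (f q) =
  (inner (D t (f p)) (f q) - inner (G' (f p)) (f q)) +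
  - (inner (D t (f p)) (f q) - inner (G (f p)) (f q)) by ring.
apply: le_trans (ler_cabsD _ _) _; rewrite [X in _ + X]/cabs normrN -/(cabs _).
by move: t1 t2; lra.
Qed.

(** The two limits of the theorem, with the two implications from which its three
    equivalences are assembled. *)
Lemma defect_limit (T : nat -> optuple H d) G :
  (forall n, opball H d M (T n)) -> coord_cvg \oo (fun n => Qop R (T n)) G ->
  exists s : K, [/\ s_ e r G N @[N --> \oo] --> s%:E,
    ereal_sup [set (h_ e R (T n) N)%:E | n in setT] @[N --> \oo] --> s%:E,
    s = 0 -> exists2 T0, opball H d M T0 & T @ \oo --> T0 &
    (forall eps, 0 < eps -> exists N, defect_sum G N <= eps) -> s = 0].
Proof.
move=> BT QG; have aQ n := Qop_admissible (BT n).
have aG : admissible G by exact: admissible_limit QG aQ.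
have [|||n eps e0|s [s1 s2 s3 s4]] := @dini_sup K
    (fun n N => defect_sum (Qop R (T n)) N) (defect_sum G).
- by move=> n N; exact: defect_sum_ge0.
- by move=> n N N'; exact: defect_sum_mono.
- by move=> N eps e0; exact: (@cvg_defect_sum _ \oo).
- exact: defect_sum_Qop_small.
exists s; split.
- by have -> : s_ e r G = (fun N => (defect_sum G N)%:E)
    by apply/funext => N; exact: s_defect_sum.
- have -> : (fun N => ereal_sup [set (h_ e R (T n) N)%:E | n in setT]) =
    (fun N => ereal_sup [set (defect_sum (Qop R (T n)) N)%:E | n in setT]) => //.
  apply/funext => N; congr (ereal_sup _); apply/seteqP; split=> _ [n _ <-].
    by exists n => //; rewrite h_defect_sum.
  by exists n => //; rewrite h_defect_sum.
- move=> s0; apply: (strong_limit BT QG) => eps e0.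
  have e20 : 0 < eps / 2 by rewrite divr_gt0.
  have [N hN] := s4 _ e20; exists N.
  have : \forall n \near \oo,
      `|defect_sum (Qop R (T n)) N - defect_sum G N| <= eps / 2.
    exact: (@cvg_defect_sum _ \oo).
  apply: filterS => n; rewrite ler_norml => /andP[_].
  by move: hN; rewrite s0; lra.
- move=> small; apply/eqP; rewrite eq_le; apply/andP; split; last first.
    by have /andP[] := s3 0%N.
  apply: le0_eps => eps /small [N hN].
  by apply: le_trans hN; have /andP[] := s3 N.
Qed.

(** * Continuity in trace norm *)

(** Parseval and Tonelli; applied both to B(T) and to B(T') - B(T), whose rows are
    the A_a R and their differences. *)
Lemma hs_norm2_row (X : bop (dsum (d + d).+1 H) H)
    (Z : 'I_(d + d).+1 -> bop H H) (c : K) :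
  (forall a x, X (dinj a x) = Z a (R x)) ->
  (forall n, \sum_(k < n) \sum_a hnorm (Z a (R (e k))) ^+ 2 <= c) ->
  (hs_norm2 e (adj X) <= c%:E)%E /\ (hs_norm2 f X <= c%:E)%E.
Proof.
move=> XZ Zc.
have of_ := @dsum_basis_orthonormal _ d _ _ oe.
have h : (hs_norm2 e (adj X) <= c%:E)%E.
  rewrite hs_norm2E.
  have -> : (\esum_(k in setT) (hnorm (adj X (e k)) ^+ 2)%:E =
     \sum_a \esum_(k in setT) \esum_(l in setT)
       (cabs (inner (e k) (Z a (R (e l)))) ^+ 2)%:E)%E.
    rewrite -esum_sum => [|k a _ _]; last by apply: esum_ge0 => l _; rewrite lee_fin sqr_ge0.
    apply: eq_esum => k _; rewrite hnorm_dsum -sumEFin; apply: eq_bigr => a _.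
    rewrite -pe; apply: eq_esum => l _; congr ((cabs _ ^+ 2)%:E).
    by rewrite -inner_dinj adjPr XZ.
  under eq_bigr => a _.
    rewrite exchange_esum => [|k l]; last by rewrite lee_fin sqr_ge0.
    under eq_esum => l _.
      under eq_esum => k _ do rewrite innerC cabs_conj.
      rewrite pe; over.
    over.
  rewrite -esum_sum => [|l a _ _]; last by rewrite lee_fin sqr_ge0.
  under eq_esum do rewrite sumEFin.
  by apply/esum_natP => // k; apply: sumr_ge0 => a _; exact: sqr_ge0.
split=> //.
have -> : X = X ** bop_id by exact: bopE.
by apply: le_trans h; exact: hs_norm2_comp_le.
Qed.

Lemma hnorm_Aop_le T a x : opball H d M T ->
  hnorm (Aop T a x) <= (M + 1) * hnorm x.
Proof.
move=> BT; have M0 := ball_ge0 BT; have x0 := hnorm_ge0 x.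
have [->|a0] := eqVneq a ord0.
  by rewrite Aop0 /= ler_peMl // lerDr.
by apply: le_trans (hnorm_Aop x BT a0) _; rewrite ler_wpM2r // lerDl.
Qed.

Definition row_bound : K := \sum_(a < (d + d).+1) (M + 1) ^+ 2.

Lemma row_bound_ge0 : 0 <= row_bound.
Proof. by apply: sumr_ge0 => a _; exact: sqr_ge0. Qed.

Lemma sum_row_le (Z : 'I_(d + d).+1 -> bop H H) (c : K) k : 0 <= c ->
  (forall a x, hnorm (Z a x) <= c * (M + 1) * hnorm x) -> 0 <= M ->
  \sum_a hnorm (Z a (R (e k))) ^+ 2 <= c ^+ 2 * row_bound * r k ^+ 2.
Proof.
move=> c0 Zc M0; rewrite /row_bound mulr_sumr mulr_suml; apply: ler_sum => a _.
rewrite -hnorm_R_basis -!exprMn ler_pXn2r ?nnegrE ?hnorm_ge0 //.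
by rewrite !mulr_ge0 ?hnorm_ge0 // addr_ge0.
Qed.

Lemma sum_rows_le (Z : 'I_(d + d).+1 -> bop H H) (c : K) n : 0 <= c ->
  (forall a x, hnorm (Z a x) <= c * (M + 1) * hnorm x) -> 0 <= M ->
  \sum_(k < n) \sum_a hnorm (Z a (R (e k))) ^+ 2 <= c ^+ 2 * row_bound.
Proof.
move=> c0 Zc M0; apply: le_trans (ler_sum _ (fun (k : 'I_n) _ => sum_row_le k c0 Zc M0)) _.
by rewrite -mulr_sumr ler_piMr ?sum_eigenvalues // mulr_ge0 ?sqr_ge0 ?row_bound_ge0.
Qed.

Lemma cvg_Aop (X : Type) (F : set_system X) {FF : Filter F}
    (u : X -> optuple H d) T a x : u @ F --> T ->
  (fun t => Aop (u t) a x) @ F --> Aop T a x.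
Proof.
move=> /strong_star_cvgP uT; rewrite /Aop.
case: unliftP => [i _|_]; last exact: cvg_cst.
by case: (fintype.split i) => j; have [] := uT j x.
Qed.

(** Q(T') - Q(T) = B(T')^* (B(T') - B(T)) + (B(T') - B(T))^* B(T), a sum of
    products of a bounded and a small Hilbert-Schmidt operator. *)
Lemma Qop_continuous (X : Type) (F : set_system X) {FF : Filter F}
    (u : X -> optuple H d) T :
  (\forall t \near F, opball H d M (u t)) -> opball H d M T -> u @ F --> T ->
  forall eps, 0 < eps -> \forall t \near F,
    (trace_norm f (Qop R (u t) - Qop R T)%R <= eps%:E)%E.
Proof.
move=> Bu BT uT eps e0; have M0 := ball_ge0 BT.
have of_ := @dsum_basis_orthonormal _ d _ _ oe.
have pf := @dsum_basis_parseval _ d _ _ oe pe.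
have C0 : 0 < row_bound + 1 by rewrite ltr_wpDl // row_bound_ge0.
(* With both Hilbert-Schmidt bounds inserted the trace norm is at most
   tau row_bound + eta / tau, where eta / tau = eps / 2. *)
pose tau := eps / 2 / (row_bound + 1).
have tau0 : 0 < tau by rewrite !divr_gt0.
pose eta := tau * eps / 2.
have eta0 : 0 < eta by rewrite divr_gt0 // mulr_gt0.
pose w t k := \sum_a hnorm ((Aop (u t) a - Aop T a) (R (e k))) ^+ 2.
have wbnd t : opball H d M (u t) -> forall a x,
    hnorm ((Aop (u t) a - Aop T a) x) <= 2 * (M + 1) * hnorm x.
  move=> Bt a x; rewrite bopB; apply: le_trans (ler_hnormD _ _) _; rewrite hnormN.
  by have := hnorm_Aop_le a x Bt; have := hnorm_Aop_le a x BT; lra.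
have : \forall t \near F, forall n, \sum_(k < n) w t k <= eta.
  apply: (@dominated_sums K X F _ w (fun k => 2 ^+ 2 * row_bound * r k ^+ 2)
    (2 ^+ 2 * row_bound)) => //.
  - by move=> k; rewrite mulr_ge0 ?sqr_ge0 // mulr_ge0 ?sqr_ge0 ?row_bound_ge0.
  - move=> n; rewrite -mulr_sumr ler_piMr ?sum_eigenvalues //.
    by rewrite mulr_ge0 ?sqr_ge0 ?row_bound_ge0.
  - apply: filterS Bu => t Bt k; apply/andP; split.
      by apply: sumr_ge0 => a _; exact: sqr_ge0.
    by apply: sum_row_le => //; exact: wbnd.
  - move=> k eta1 eta10.
    have h : w t k @[t --> F] --> \sum_(a < (d + d).+1) ((0 : K) * 0).
      apply: cvg_finite_sum => a _.
      have h : hnorm ((Aop (u t) a - Aop T a) (R (e k))) @[t --> F] --> (0 : K).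
        apply/cvgrPdist_lt => eta2 eta20.
        have /cvg_hnormP/(_ _ eta20) : (fun t => Aop (u t) a (R (e k))) @ F -->
          Aop T a (R (e k)) by exact: cvg_Aop.
        apply: filterS => t; rewrite sub0r normrN ger0_norm ?hnorm_ge0 //.
        by rewrite bopB hdistC.
      under eq_cvg do rewrite expr2.
      by apply: cvgM.
    rewrite mulr0 big1 // in h; move/cvgrPdist_le : h => /(_ _ eta10).
    apply: filterS => t; rewrite sub0r normrN; exact: le_trans (ler_norm _).
move: Bu; apply: filterS2 => t Bt wt.
pose X1 := Brow R (u t); pose X0 := Brow R T.
have rowX T' : opball H d M T' -> (hs_norm2 e (adj (Brow R T')) <= row_bound%:E)%E /\
    (hs_norm2 f (Brow R T') <= row_bound%:E)%E.
  move=> BT'; apply: (hs_norm2_row (Z := Aop T')); first exact: Brow_dinj.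
  move=> n; rewrite -[leRHS]mul1r -(expr1n _ 2); apply: sum_rows_le => // a x.
  by rewrite mul1r; exact: hnorm_Aop_le.
have [Da Df] : (hs_norm2 e (adj (X1 - X0)%R) <= eta%:E)%E /\
    (hs_norm2 f (X1 - X0)%R <= eta%:E)%E.
  apply: (hs_norm2_row (Z := fun a => Aop (u t) a - Aop T a)); last exact: wt.
  by move=> a x; rewrite !bopB /X1 /X0 !Brow_dinj.
have [X1a _] := rowX _ Bt; have [_ X0f] := rowX _ BT.
have -> : Qop R (u t) - Qop R T = adj X1 ** (X1 - X0) + adj (X1 - X0) ** X0.
  apply: bopE => x; apply: inner_inj => y.
  rewrite bopB bopD linearBr linearDr /= -!adjP !bopB !linearBr linearBl /=.
  by ring.
have -> : eps = (tau * row_bound + tau^-1 * eta) / 2 +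
    (tau^-1 * eta + tau * row_bound) / 2 + tau.
  rewrite /eta; have -> : tau^-1 * (tau * eps / 2) = eps / 2.
    by rewrite -[tau * eps / 2]mulrA mulKf ?gt_eqF.
  have : tau * (row_bound + 1) = eps / 2 by rewrite /tau divfK ?gt_eqF.
  by lra.
apply: (@le_trans _ _ (((tau * row_bound + tau^-1 * eta) / 2 +
    (tau^-1 * eta + tau * row_bound) / 2)%:E)%E); last by rewrite lee_fin lerDl ltW.
apply: trace_norm_triangle => //.
  exact: (trace_norm_adj_comp of_ pf pe tau0 X1a Df).
have := trace_norm_adj_comp of_ pf pe (_ : 0 < tau^-1) Da X0f.
by rewrite invrK invr_gt0; apply.
Qed.

Lemma coord_cvg_of_trace_norm (X : Type) (F : set_system X) {FF : Filter F}
    (D : X -> op) G :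
  (forall eps, 0 < eps -> \forall t \near F,
     (trace_norm f (D t - G)%R <= eps%:E)%E) ->
  coord_cvg F D G.
Proof.
have of_ := @dsum_basis_orthonormal _ d _ _ oe.
have pf := @dsum_basis_parseval _ d _ _ oe pe.
move=> h p q; apply/cvgrPdist_le => eps /h; apply: filterS => t ht.
rewrite sub0r normrN ger0_norm ?cabs_ge0 //.
have := inner_le_trace_norm p q of_ pf ht.
by rewrite bopB linearBl.
Qed.

Lemma coord_cvg_Qop (T : nat -> optuple H d) T0 :
  (forall n, opball H d M (T n)) -> opball H d M T0 -> T @ \oo --> T0 ->
  coord_cvg \oo (fun n => Qop R (T n)) (Qop R T0).
Proof.
move=> BT BT0 TT0; apply: coord_cvg_of_trace_norm.
by apply: Qop_continuous => //; exact: nearW.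
Qed.

(** * The topologies of the trace norm *)

Lemma Qop_trace_class T : opball H d M T -> trace_class f (Qop R T).
Proof.
move=> BT; have M0 := ball_ge0 BT.
have of_ := @dsum_basis_orthonormal _ d _ _ oe.
have pf := @dsum_basis_parseval _ d _ _ oe pe.
have [Xa Xf] : (hs_norm2 e (adj (Brow R T)) <= row_bound%:E)%E /\
    (hs_norm2 f (Brow R T) <= row_bound%:E)%E.
  apply: (hs_norm2_row (Z := Aop T)); first exact: Brow_dinj.
  move=> n; rewrite -[leRHS]mul1r -(expr1n _ 2); apply: sum_rows_le => // a x.
  by rewrite mul1r; exact: hnorm_Aop_le.
apply: le_lt_trans (trace_norm_adj_comp of_ pf pe ltr01 Xa Xf) _.
exact: ltry.
Qed.

(** H(T) is the sum of the Y_a^* Y_a with Y_a = R A_a^*, whose adjoints A_a R are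
    Hilbert-Schmidt. *)
Lemma Hop_trace_class T : opball H d M T -> trace_class e (Hop R T).
Proof.
move=> BT; have M0 := ball_ge0 BT.
suff [c hc] : exists c : K, (trace_norm e (Hop R T) <= c%:E)%E.
  by apply: le_lt_trans hc _; exact: ltry.
rewrite /Hop; elim/big_ind: _ => [|A B [a ha] [b hb]|a a0].
- exists 0; apply/trace_norm_leP => // U s _ _.
  by rewrite big1 // => i _; rewrite linear0l /cabs normr0.
- by exists (a + b); exact: trace_norm_triangle.
pose Y := R ** adj (Aop T a).
have adjY : adj Y = Aop T a ** R.
  by apply: adj_unique => x y; rewrite /= positive_sym // adjPr.
have hY : (hs_norm2 e (adj Y) <= (M ^+ 2)%:E)%E.
  rewrite hs_norm2E; apply/esum_natP => [k|n]; first exact: sqr_ge0.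
  apply: (@le_trans _ _ (\sum_(k < n) M ^+ 2 * r k ^+ 2)); last first.
    by rewrite -mulr_sumr ler_piMr ?sqr_ge0 ?sum_eigenvalues.
  apply: ler_sum => k _; rewrite adjY -hnorm_R_basis -exprMn.
  rewrite ler_pXn2r ?nnegrE ?mulr_ge0 ?hnorm_ge0 //; exact: hnorm_Aop.
have hY' : (hs_norm2 e Y <= (M ^+ 2)%:E)%E.
  have -> : Y = Y ** bop_id by exact: bopE.
  by apply: le_trans hY; exact: hs_norm2_comp_le.
have -> : Aop T a ** (R ** R) ** adj (Aop T a) = adj Y ** Y.
  by apply: bopE => x; rewrite adjY.
by eexists; exact: (trace_norm_adj_comp oe pe pe ltr01 hY hY').
Qed.

Lemma Qop_inj T T' : Qop R T = Qop R T' -> T = T'.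
Proof.
move=> QQ; apply/funext => j; apply: (bop_eq_on_basis pe pe) => k l.
pose a := lift ord0 (lshift d j).
have := inner_Qop T a k ord0 l; rewrite QQ inner_Qop !Aop0 /a !Aop_left /=.
rewrite !R_diag !linearZ /= !linearZl_LR !linearZr_LR /=.
have rC m : (r m)%:C%C != 0 :> K[i].
  by rewrite (fmorph_eq0 (@real_complex K)) eigenvalue_neq0.
move=> h; apply/esym; move: h => /(mulfI (rC k)); apply: mulfI.
by rewrite conjC_eq0.
Qed.

(** The limit G = Q(T0) has s = 0, so T_n converges strongly-*; its limit has the
    same image as T0 under the injective map Q. *)
Lemma cvg_of_coord_cvg (T : nat -> optuple H d) T0 :
  (forall n, opball H d M (T n)) -> opball H d M T0 ->
  coord_cvg \oo (fun n => Qop R (T n)) (Qop R T0) -> T @ \oo --> T0.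
Proof.
move=> BT BT0 QQ; have [s [_ _ h1 h2]] := defect_limit BT QQ.
have [|T1 BT1 TT1] := h1.
  by apply: h2 => eps e0; exact: defect_sum_Qop_small.
suff -> : T0 = T1 by [].
apply: Qop_inj; apply: coord_cvg_unique QQ _.
exact: coord_cvg_Qop.
Qed.

Lemma near_natSinv_le (eps : K) : 0 < eps ->
  \forall n \near \oo, (n.+1%:R^-1 : K) <= eps.
Proof.
by move=> e0; apply: filterS (near_infty_natSinv_lt (PosNum e0)) => n /ltW.
Qed.

(** Every T0 in B and U has a trace-norm ball around Q(T0) whose preimage in B lies
    in U, as otherwise tuples outside U, with images at distance less than
    1 / (n + 1) from Q(T0), would converge to T0.  The open set sought is the
    union of these balls. *)
Lemma Qop_embedding :
  embedding_on (opball H d M) (Qop R : optuple H d -> trace_space f).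
Proof.
have of_ := @dsum_basis_orthonormal _ d _ _ oe.
have pf := @dsum_basis_parseval _ d _ _ oe pe.
split.
- by move=> T T' _ _; exact: Qop_inj.
- apply/subspace_continuousP => T BT U /trace_nbhsP [c c0 cU].
  have c20 : 0 < c / 2 by rewrite divr_gt0.
  have h : \forall T' \near within (opball H d M) (nbhs T),
      (trace_norm f (Qop R T' - Qop R T)%R <= (c / 2)%:E)%E.
    move: c20; apply: Qop_continuous => //; first exact: withinT.
    exact: cvg_within.
  apply: filterS h => T' hT'; apply: cU; apply: le_lt_trans hT' _.
  by rewrite lte_fin ltr_pdivrMr // ltr_pMr // ltr1n.
move=> U oU.
have key T0 : opball H d M T0 -> U T0 -> exists2 c : K, 0 < c &
    forall T, opball H d M T ->
      (trace_norm f (Qop R T - Qop R T0)%R < c%:E)%E -> U T.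
  move=> BT0 UT0; apply: contrapT => /forall2NP no.
  have /choice [T hT] : forall n : nat, exists T, [/\ opball H d M T,
      (trace_norm f (Qop R T - Qop R T0)%R < (n.+1%:R^-1)%:E)%E & ~ U T].
    move=> n; have [|] := no n.+1%:R^-1; first by rewrite invr_gt0.
    move=> /existsNP [T /not_implyP [BT /not_implyP [lt nU]]].
    by exists T.
  have TT0 : T @ \oo --> T0.
    apply: cvg_of_coord_cvg => // [n|]; first by have [] := hT n.
    apply: coord_cvg_of_trace_norm => eps e0.
    near=> n; have [_ h _] := hT n; apply: le_trans (ltW h) _; rewrite lee_fin.
    by near: n; exact: near_natSinv_le.
  have [n _ hn] : \forall n \near \oo, U (T n).
    by apply: TT0; apply: open_nbhs_nbhs; split.
  by have [_ _] := hT n; apply; exact: hn (leqnn n).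
pose J := {p : optuple H d * K | [/\ opball H d M p.1, U p.1, 0 < p.2 &
  forall T, opball H d M T ->
    (trace_norm f (Qop R T - Qop R p.1)%R < p.2%:E)%E -> U T]}.
exists (\bigcup_(p : J) [set A : trace_space f |
  (trace_norm f ((A : op) - Qop R (sval p).1)%R < (sval p).2%:E)%E]).
  by apply: bigcup_open => p _; exact: trace_ball_open.
apply/seteqP; split=> [A [T [BT UT] <-]|A [[T BT <-] [[[T0 c] [/= _ _ _ h]] _ /= lt]]].
  split; first by exists T.
  have [c c0 hc] := key T BT UT.
  exists (exist _ (T, c) (And4 BT UT c0 hc)) => //=.
  by rewrite subrr trace_norm0 // lte_fin.
by exists T => //; split=> //; exact: h.
Unshelve. all: by end_near. Qed.

(** * The enhanced map *)

Lemma cvg_strong_comp (A : nat -> bop H H) (L : bop H H) (c : K) (u : nat -> H) x :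
  0 <= c -> (forall n y, hnorm (A n y) <= c * hnorm y) ->
  (forall y, A n y @[n --> \oo] --> L y) -> u n @[n --> \oo] --> x ->
  A n (u n) @[n --> \oo] --> L x.
Proof.
move=> c0 Ac AL ux; apply/cvg_hnormP => eps e0.
have e20 : 0 < eps / 2 by rewrite divr_gt0.
have d0 : 0 < eps / 2 / (c + 1) by rewrite divr_gt0 // ltr_wpDl.
near=> n; rewrite -(subrKA (A n x)) -linearB.
apply: le_lt_trans (ler_hnormD _ _) _; rewrite [ltRHS]splitr; apply: ltr_leD.
  by near: n; exact: ((cvg_hnormP _ _).1 (AL x) _ e20).
apply: le_trans (Ac _ _) _.
have : hnorm (x - u n) < eps / 2 / (c + 1).
  by near: n; exact: ((cvg_hnormP _ _).1 ux _ d0).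
rewrite ltr_pdivlMr ?ltr_wpDl // => /ltW; apply: le_trans.
by rewrite mulrC ler_wpM2l ?hnorm_ge0 // lerDl.
Unshelve. all: by end_near. Qed.

Lemma cvg_Hop (T : nat -> optuple H d) T0 x :
  (forall n, opball H d M (T n)) -> T @ \oo --> T0 ->
  Hop R (T n) x @[n --> \oo] --> Hop R T0 x.
Proof.
move=> BT TT0; have M0 := ball_ge0 (BT 0).
rewrite /Hop bop_sum; under eq_cvg do rewrite bop_sum.
apply: cvg_finite_sum => a a0.
apply: (@cvg_strong_comp (fun n => Aop (T n) a) (Aop T0 a) M
  (fun n => (R ** R) (adj (Aop (T n) a) x)) ((R ** R) (adj (Aop T0 a) x))) => //.
- by move=> n y; exact: hnorm_Aop.
- by move=> y; exact: (@cvg_Aop _ \oo _ T).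
apply: continuous_cvg; first exact: (@bop_continuous _ _ _ (R ** R)).
have aa : exists2 b, b != ord0 & forall T', adj (Aop T' a) = Aop T' b.
  have [j ->] : exists j, a = lift ord0 j.
    by case: (unliftP ord0 a) a0 => [j -> _|->]; [exists j|rewrite eqxx].
  rewrite -(splitK j); case: (fintype.split j) => i /=.
    by exists (lift ord0 (rshift d i)); rewrite ?lift_neq0 // => T';
      rewrite Aop_left Aop_right.
  by exists (lift ord0 (lshift d i)); rewrite ?lift_neq0 // => T';
    rewrite Aop_left Aop_right adjK.
have [b _ hb] := aa; rewrite hb; under eq_cvg do rewrite hb.
exact: (@cvg_Aop _ \oo _ T).
Qed.

(** Trace-norm convergence of H(T_n) to a trace class operator makes the tails
    of Tr H(T_n) uniformly small, and so forbids a positive defect. *)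
Lemma defect_small_of_Hop_cvg (T : nat -> optuple H d) G (L : bop H H) :
  (forall n, opball H d M (T n)) -> coord_cvg \oo (fun n => Qop R (T n)) G ->
  trace_class e L ->
  (forall eps, 0 < eps -> \forall n \near \oo,
     (trace_norm e (Hop R (T n) - L)%R <= eps%:E)%E) ->
  forall eps, 0 < eps -> exists N, defect_sum G N <= eps.
Proof.
move=> BT QG Ltc HL eps e0; have aQ n := Qop_admissible (BT n).
have aG : admissible G by exact: admissible_limit QG aQ.
have e30 : 0 < eps / 3 by rewrite divr_gt0.
have [c Lc] : exists c : K, (trace_norm e L <= c%:E)%E.
  move: Ltc (trace_norm_ge0 e L); rewrite /trace_class /=.
  by case: (trace_norm e L) => [c| |] // _ _; exists c.
pose v l := cabs (inner (L (e l)) (e l)).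
have vc n : \sum_(l < n) v l <= c.
  rewrite (sum_ordE v); apply: sum_diag_le_trace_norm => //.
  exact: iota_uniq.
have v0 l : 0 <= v l by exact: cabs_ge0.
have [N hN] := bounded_partial_sums_cauchy v0 vc e30.
exists N.
have h1 : \forall n \near \oo,
    `|defect_sum (Qop R (T n)) N - defect_sum G N| <= eps / 3.
  exact: (@cvg_defect_sum _ \oo).
have [n [/= hn1 hn2]] := filter_ex (filterI h1 (HL _ e30)).
have : defect_sum (Qop R (T n)) N <= eps / 3 + eps / 3.
  rewrite -lee_fin -(defect_sum_tail N (BT n)).
  apply/esum_natP => [l|m].
    case: ifP => // _; rewrite inner_Hop /=.
    by apply: sumr_ge0 => a _; exact: sqr_ge0.
  case: (leqP m N) => [mN|/ltnW Nm].
    by rewrite big1 ?addr_ge0 ?ltW // => l _; rewrite (leq_trans (ltn_ord l) mN).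
  rewrite -(big_mkord xpredT (fun l => if (l < N)%N then 0 else
    complex.Re (inner (Hop R (T n) (e l)) (e l)))).
  rewrite (big_cat_nat (leq0n N) Nm) /= big_nat big1 ?add0r => [|l /andP[_ ->] //].
  apply: (@le_trans _ _ (\sum_(N <= l < m) v l +
     \sum_(N <= l < m) cabs (inner ((Hop R (T n) - L) (e l)) (e l)))).
    rewrite -big_split big_nat [leRHS]big_nat; apply: ler_sum => l /andP[Nl _].
    change ((if (l < N)%N then 0 else complex.Re (inner (Hop R (T n) (e l)) (e l)))
      <= v l + cabs (inner ((Hop R (T n) - L) (e l)) (e l))).
    rewrite ltnNge Nl bopB linearBl [X in X <= _]/=.
    apply: le_trans (Re_le_cabs _) (le_trans _ (ler_cabsD _ _)).
    by rewrite addrC subrK.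
  apply: lerD; first exact/ltW/hN.
  by rewrite /index_iota; apply: sum_diag_le_trace_norm => //; exact: iota_uniq.
by move: hn1; rewrite ler_norml => /andP[]; lra.
Qed.

(** C is the closure of the image.  A trace class point (G, L) of C is the limit
    of a sequence of images of T_n; s = 0 by defect_small_of_Hop_cvg, so T_n has a
    strong-* limit T0, and G = Q(T0), L = H(T0) by comparison of entries. *)
Lemma enhanced_image_closed :
  exists2 C : set (trace_space f * trace_space e)%type, closed C &
    (fun T => (Qop R T, Hop R T)) @` opball H d M
      = C `&` (trace_class f `*` trace_class e).
Proof.
have of_ := @dsum_basis_orthonormal _ d _ _ oe.
have pf := @dsum_basis_parseval _ d _ _ oe pe.
pose E : set (trace_space f * trace_space e)%type :=
  (fun T => (Qop R T, Hop R T)) @` opball H d M.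
exists (closure E); first exact: closed_closure.
apply/seteqP; split=> [p Ep|[G L] [cl [/= _ Ltc]]].
  split; first exact: subset_closure.
  case: Ep => T BT <-; split; [exact: Qop_trace_class|exact: Hop_trace_class].
have /choice [T hT] : forall n : nat, exists T, [/\ opball H d M T,
    (trace_norm f (Qop R T - G)%R < (n.+1%:R^-1)%:E)%E &
    (trace_norm e (Hop R T - L)%R < (n.+1%:R^-1)%:E)%E].
  move=> n; have n0 : 0 < n.+1%:R^-1 :> K by rewrite invr_gt0.
  have [|_ [[T BT <-] [/= h1 h2]]] := cl
    ([set A | (trace_norm f (A - G)%R < (n.+1%:R^-1)%:E)%E] `*`
     [set A | (trace_norm e (A - L)%R < (n.+1%:R^-1)%:E)%E]).
    exists ([set A | (trace_norm f (A - G)%R < (n.+1%:R^-1)%:E)%E],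
     [set A | (trace_norm e (A - L)%R < (n.+1%:R^-1)%:E)%E]) => //.
    by split; exact: trace_ball_nbhs.
  by exists T.
have BT n : opball H d M (T n) by have [] := hT n.
have QG : coord_cvg \oo (fun n => Qop R (T n)) G.
  apply: coord_cvg_of_trace_norm => eps /near_natSinv_le; apply: filterS => n hn.
  by have [_ h _] := hT n; apply: le_trans (ltW h) _; rewrite lee_fin.
have HL eps : 0 < eps -> \forall n \near \oo,
     (trace_norm e (Hop R (T n) - L)%R <= eps%:E)%E.
  move=> /near_natSinv_le; apply: filterS => n hn.
  by have [_ _ h] := hT n; apply: le_trans (ltW h) _; rewrite lee_fin.
have [s [_ _ h1 h2]] := defect_limit BT QG.
have [|T0 BT0 TT0] := h1; first exact/h2/(defect_small_of_Hop_cvg BT QG Ltc HL).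
exists T0 => //; congr (_, _).
  exact: coord_cvg_unique (coord_cvg_Qop BT BT0 TT0) QG.
apply: (bop_eq_on_basis pe pe) => k l.
apply/eqP; rewrite -subr_eq0; apply/eqP/cabs_eq0.
apply/eqP; rewrite eq_le cabs_ge0 andbT; apply: le0_eps => eps e0.
have e20 : 0 < eps / 2 by rewrite divr_gt0.
have c1 : \forall n \near \oo,
    cabs (inner (Hop R T0 (e k) - Hop R (T n) (e k)) (e l)) < eps / 2.
  exact: (cvg_inner (e l) (@cvg_Hop T T0 (e k) BT TT0) e20).
have [n [/= t1 t2]] := filter_ex (filterI c1 (HL _ e20)).
have t3 := inner_le_trace_norm k l oe pe t2.
have -> : inner (Hop R T0 (e k)) (e l) - inner (L (e k)) (e l) =
  inner (Hop R T0 (e k) - Hop R (T n) (e k)) (e l) +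
  inner ((Hop R (T n) - L) (e k)) (e l).
  by rewrite bopB !linearBl /=; ring.
apply: le_trans (ler_cabsD _ _) _.
by move: t1 t3; lra.
Qed.

End Defect.

Theorem theorem8p3 (K : realType) (H : hilbertType K)
    (e : nat -> H) (r : nat -> K) (R : bop H H) (d : nat) (M : K)
    (e_onb : is_onb e)
    (R_pos : positive_op R) (R_inj : injective R) (R_hs : hs_norm2 e R = 1%E)
    (R_diag : forall k, R (e k) = (r k)%:C%C *: e k)
    (d_gt0 : (0 < d)%N) :
  let B := opball H d M in
  let f := dsum_basis d e in
  [/\ forall (T : nat -> optuple H d)
        (G : bop (dsum (d + d).+1 H) (dsum (d + d).+1 H)),
        (forall n, B (T n)) ->
        trace_norm f (Qop R (T n) - G)%R @[n --> \oo] --> 0%E ->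
        exists s : K,
        [/\ s_ e r G N @[N --> \oo] --> s%:E,
            ereal_sup [set (h_ e R (T n) N)%:E | n in setT] @[N --> \oo]
              --> s%:E,
            s = 0 <-> (exists2 T0, B T0 & G = Qop R T0),
            s = 0 <-> (exists2 T0, B T0 & T @ \oo --> T0) &
            s = 0 <-> (exists T0, [/\ B T0, G = Qop R T0 & T @ \oo --> T0])],
      (forall T, B T -> trace_class f (Qop R T) /\ trace_class e (Hop R T)),
      embedding_on B (Qop R : optuple H d -> trace_space f) &
      exists2 C : set (trace_space f * trace_space e)%type, closed C &
        (fun T => (Qop R T, Hop R T)) @` B
          = C `&` (trace_class f `*` trace_class e)].
Proof.
move=> B f; split.
- move=> T G BT QG.
  have QG' : coord_cvg e \oo (fun n => Qop R (T n)) G.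
    apply: coord_cvg_of_trace_norm => // eps e0.
    have /fine_cvgP [fin /cvgrPdist_le/(_ _ e0)] := QG.
    apply: filterS2 fin => n /=; case: (trace_norm _ _) => //= c _.
    rewrite sub0r normrN lee_fin; exact: le_trans (ler_norm _).
  have [s [s1 s2 s3 s4]] := defect_limit e_onb R_pos R_inj R_hs R_diag d_gt0 BT QG'.
  have GT T0 : B T0 -> T @ \oo --> T0 -> G = Qop R T0.
    move=> BT0 /(coord_cvg_Qop e_onb R_hs R_diag d_gt0 BT BT0).
    exact: (coord_cvg_unique e_onb).
  have zT T0 : B T0 -> G = Qop R T0 -> s = 0.
    move=> BT0 GE; apply: s4 => eps e0; rewrite GE.
    exact: (defect_sum_Qop_small e_onb R_inj R_hs R_diag d_gt0 BT0).
  exists s; split=> //; split.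
  + by move=> /s3 [T0 BT0 TT0]; exists T0 => //; exact: GT.
  + by move=> [T0 BT0]; exact: zT.
  + exact: s3.
  + by move=> [T0 BT0 /(GT _ BT0)]; exact: zT.
  + by move=> /s3 [T0 BT0 TT0]; exists T0; split=> //; exact: GT.
  + by move=> [T0 [BT0 GE _]]; exact: zT GE.
- move=> T BT; split; first exact: Qop_trace_class BT.
  exact: Hop_trace_class BT.
- exact: Qop_embedding.
- exact: enhanced_image_closed.
Qed.
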